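(* Let $\gamma_1,\gamma_2,\dots\ge1$ and, for each $k\ge1$, let $\mu_k$ be the limiting Gram spectral law of the depth-$k$ Gaussian product $X_p^{(k)}=G_kG_{k-1}\cdots G_1$ described in the context. Then for every $k\ge1$, $\mu_{k+1}\succeq_{\rm St}\mu_k$; hence, for every $\sigma^2>0$, $L_{\mu_{k+1}}(\omega)\ge L_{\mu_k}(\omega)$ for every $\omega>0$. Consequently adding an independent Gaussian layer cannot decrease the Bayes-VAMP lower bound: for every law $\pi$ on $\mathbb R$ with finite second moment and every $\sigma^2>0$, $m_\pi(\tau_B^+(\mu_{k+1}))\ge m_\pi(\tau_B^+(\mu_k))$.
   Context: **Gaussian products.** $n_0=p$, and for $\ell\ge1$, $G_\ell\in\mathbb R^{n_\ell\times n_{\ell-1}}$ are mutually independent with iid $N(0,1/n_\ell)$ entries, where $n_\ell=n_\ell(p)$ and $n_\ell/p\to\gamma_\ell\ge1$ as $p\to\infty$. For each fixed $k$, the empirical eigenvalue law of $(X_p^{(k)})^TX_p^{(k)}$ converges weakly (in probability) to the deterministic law $\mu_k=\mu_{{\rm MP},\gamma_1}\boxtimes\cdots\boxtimes\mu_{{\rm MP},\gamma_k}$ (a known fact), where $\boxtimes$ is multiplicative free convolution and, for $\gamma\ge1$, $\mu_{{\rm MP},\gamma}$ is the mean-one Marchenko–Pastur law with density $\frac{\gamma}{2\pi s}\sqrt{(s_+-s)(s-s_-)}$ on $[s_-,s_+]$, $s_\pm=(1\pm\gamma^{-1/2})^2$. **Orders and maps.** $\mu_2\succeq_{\rm St}\mu_1$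 means $\mathbb E_{\mu_2}[1/(S+c)]\ge\mathbb E_{\mu_1}[1/(S+c)]$ for all $c>0$. For a compactly supported law $\mu$ on $[0,\infty)$ with positive mean: for $\omega>0$, $L_\mu(\omega)=\mathbb E_\mu\big[\frac{\sigma^2\omega}{\sigma^2+\omega S}\big]\big/\mathbb E_\mu\big[\frac{\omega S}{\sigma^2+\omega S}\big]$, and $L_\mu(0)=\sigma^2/\mathbb E_\mu[S]$. With $B^\star\sim\pi$, $Z\sim N(0,1)$ independent: $m_\pi(\tau)=\mathbb E[(\mathbb E[B^\star\mid B^\star+\sqrt\tau Z]-B^\star)^2]$, $\mathcal E_\pi(\tau)=\dfrac{m_\pi(\tau)}{1-m_\pi(\tau)/\tau}$, $\tau_B^+(\mu)=\max\{\tau>0:L_\mu(\mathcal E_\pi(\tau))=\tau\}$. *)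

(* Defs.v *)
From HB Require Import structures.
From mathcomp Require Import all_boot all_order all_algebra.
From mathcomp Require Import complex.
From mathcomp Require Import all_classical all_reals all_analysis.

Set Implicit Arguments.
Unset Strict Implicit.
Unset Printing Implicit Defensive.

Import Order.TTheory GRing.Theory Num.Theory.
Import numFieldNormedType.Exports.

Local Open Scope classical_set_scope.
Local Open Scope ring_scope.

(** ** Gaussian products and their Gram spectra *)

Definition mutually_independent (R : realType) (d : measure_display)
    (T : measurableType d) (P : probability T R) (I : eqType)
    (X : I -> {RV P >-> R}) : Prop :=
  forall (s : seq I) (A : I -> set R), uniq s ->
    (forall i, measurable (A i)) ->
    P (\big[setI/setT]_(i <- s) (X i @^-1` A i)) =
    (\prod_(i <- s) P (X i @^-1` A i))%E.

(* [layers P n] holds one realization of all the layers for a given size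
   sequence [n]; [G l] is the [n l.+1] x [n l] matrix written G_(l+1) when
   layers are numbered from 1. *)
Definition layers (R : realType) (d : measure_display) (T : measurableType d)
    (P : probability T R) (n : nat -> nat) : Type :=
  forall l : nat, 'I_(n l.+1) -> 'I_(n l) -> {RV P >-> R}.

Section gaussian_products.
Context (R : realType) (d : measure_display) (T : measurableType d).
Context (P : probability T R) (n : nat -> nat).

Definition layer_entry (G : layers P n)
    (x : {l : nat & ('I_(n l.+1) * 'I_(n l))%type}) : {RV P >-> R} :=
  G (tag x) (tagged x).1 (tagged x).2.

(* The second parameter of [normal_prob] is the standard deviation. *)
Definition gaussian_layers (G : layers P n) : Prop :=
  (forall (l : nat) (i : 'I_(n l.+1)) (j : 'I_(n l)) (A : set R),
     measurable A ->
     distribution P (G l i j) A =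
     normal_prob 0 (Num.sqrt ((n l.+1)%:R^-1)) A) /\
  mutually_independent (layer_entry G).

Definition layer_matrix (G : layers P n) (l : nat) (w : T) :
    'M[R]_(n l.+1, n l) :=
  \matrix_(i, j) G l i j w.

Fixpoint layer_product (G : layers P n) (k : nat) (w : T) :
    'M[R]_(n k, n 0%N) :=
  match k with
  | 0%N => 1%:M
  | k'.+1 => layer_matrix G k' w *m layer_product G k' w
  end.

Definition gram (G : layers P n) (k : nat) (w : T) : 'M[R]_(n 0%N) :=
  (layer_product G k w)^T *m layer_product G k w.

End gaussian_products.

(* The eigenvalues with algebraic multiplicity, in some order; the default is
   used only when the characteristic polynomial does not split over [R], which
   never happens for a symmetric matrix. *)
Definition eigenvalues (R : realType) (N : nat) (M : 'M[R]_N) : seq R :=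
  xget [::] [set s | char_poly M = \prod_(x <- s) ('X - x%:P)].

Definition empirical_spectral_law (R : realType) (N : nat) (M : 'M[R]_N) :
    {measure set (measurableTypeR R) -> \bar R} :=
  let s := eigenvalues M in
  mscale (N%:R^-1 : R)%:nng
    (msum (fun i => \d_(nth 0 s i : measurableTypeR R)) (size s)).

Definition weak_cvg_in_probability (R : realType) (d : measure_display)
    (T : measurableType d) (P : probability T R)
    (nu : nat -> T -> {measure set (measurableTypeR R) -> \bar R})
    (mu : probability (measurableTypeR R) R) : Prop :=
  forall f : R -> R, continuous f -> (exists M : R, forall x, `|f x| <= M) ->
  forall e : R, 0 < e ->
    (fun p => P [set w | e <= `|\int[nu p w]_x f x - \int[mu]_x f x|])
      @ \oo --> 0%E.

(** ** Marchenko-Pastur laws and multiplicative free convolution *)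

Definition mp_density (R : realType) (g s : R) : R :=
  let sm := (1 - (Num.sqrt g)^-1) ^+ 2 in
  let sp := (1 + (Num.sqrt g)^-1) ^+ 2 in
  if sm <= s <= sp then
    g / (2 * pi * s) * Num.sqrt ((sp - s) * (s - sm))
  else 0.

Definition has_density (R : realType)
    (mu : probability (measurableTypeR R) R) (f : R -> R) : Prop :=
  forall A : set R, measurable A ->
    mu A = (\int[lebesgue_measure]_(s in A) (f s)%:E)%E.

Definition compact_support_nonneg (R : realType)
    (mu : probability (measurableTypeR R) R) : Prop :=
  exists M : R, mu (~` `[0, M]) = 0%E.

Definition moment (R : realType) (mu : probability (measurableTypeR R) R)
    (j : nat) : R := \int[mu]_s s ^+ j.

(* Freeness of the unital algebras generated by [a] and [b] in (A, phi). A word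
   is a list of letters (c, q), read as q(a) if c and as q(b) otherwise. *)
Definition free_pair (K : fieldType) (A : algType K) (phi : A -> K)
    (a b : A) : Prop :=
  let letter (x : bool * {poly K}) := horner_alg (if x.1 then a else b) x.2 in
  forall s : seq (bool * {poly K}), s != [::] ->
    sorted (fun x y => x.1 != y.1) s ->
    (forall x, x \in s -> phi (letter x) = 0) ->
    phi (\prod_(x <- s) letter x) = 0.

(* [rho] is the law of a product of free variables with laws [mu] and [nu].
   Freeness and commutativity of C[a], C[b] make [phi] tracial on the algebra
   generated by [a] and [b], so the moments of [a * b] are those of
   a^(1/2) b a^(1/2); a compactly supported law is determined by its moments. *)
Definition is_free_mul_convolution (R : realType)
    (mu nu rho : probability (measurableTypeR R) R) : Prop :=
  [/\ compact_support_nonneg mu, compact_support_nonneg nu,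
      compact_support_nonneg rho &
      exists (A : algType R[i]) (phi : {linear A -> R[i]^o}) (a b : A),
        [/\ phi 1 = 1, free_pair phi a b &
            forall j : nat,
              [/\ phi (a ^+ j) = (moment mu j)%:C%C,
                  phi (b ^+ j) = (moment nu j)%:C%C &
                  phi ((a * b) ^+ j) = (moment rho j)%:C%C]]].

(** ** The order, the map L and the Bayes-VAMP fixed point *)

Definition stieltjes_ge (R : realType)
    (mu2 mu1 : probability (measurableTypeR R) R) : Prop :=
  forall c : R, 0 < c ->
    \int[mu1]_s (1 / (s + c)) <= \int[mu2]_s (1 / (s + c)).

(* [s2] is the noise variance sigma^2. *)
Definition Lmap (R : realType) (s2 : R)
    (mu : probability (measurableTypeR R) R) (w : R) : R :=
  if w == 0 then s2 / \int[mu]_s s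
  else (\int[mu]_s (s2 * w / (s2 + w * s))) /
       (\int[mu]_s (w * s / (s2 + w * s))).

Definition is_cond_expectation (R : realType) (d : measure_display)
    (T : measurableType d) (P : {measure set T -> \bar R})
    (X Y f : T -> R) : Prop :=
  [/\ forall B : set R, measurable B ->
        g_sigma_algebra_preimage Y (f @^-1` B),
      P.-integrable setT (EFin \o f) &
      forall A : set T, g_sigma_algebra_preimage Y A ->
        (\int[P]_(w in A) (f w)%:E = \int[P]_(w in A) (X w)%:E)%E].

(* A version of E[X | Y]; it exists as soon as [X] is integrable. *)
Definition cond_expectation (R : realType) (d : measure_display)
    (T : measurableType d) (P : {measure set T -> \bar R})
    (X Y : T -> R) : T -> R :=
  xget (cst 0) [set f | is_cond_expectation P X Y f].

(* The pair (B, Z) is realized as the coordinates of R * R under the product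
   of its marginal laws. *)
Definition mmse (R : realType) (Pi : probability (measurableTypeR R) R)
    (tau : R) : R :=
  let P := (Pi \x normal_prob (0 : R) 1)%E in
  let B := fun w : R * R => w.1 in
  let Y := fun w : R * R => w.1 + Num.sqrt tau * w.2 in
  \int[P]_w (cond_expectation P B Y w - B w) ^+ 2.

Definition extrinsic_mmse (R : realType)
    (Pi : probability (measurableTypeR R) R) (tau : R) : R :=
  mmse Pi tau / (1 - mmse Pi tau / tau).

Definition fixed_points (R : realType) (s2 : R)
    (Pi mu : probability (measurableTypeR R) R) : set R :=
  [set tau | 0 < tau /\ Lmap s2 mu (extrinsic_mmse Pi tau) = tau].

Definition is_tauB_plus (R : realType) (s2 : R)
    (Pi mu : probability (measurableTypeR R) R) (tau : R) : Prop :=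
  fixed_points s2 Pi mu tau /\ ubound (fixed_points s2 Pi mu) tau.

Definition finite_second_moment (R : realType)
    (Pi : probability (measurableTypeR R) R) : Prop :=
  (\int[Pi]_b (b ^+ 2)%:E < +oo)%E.

(* Main.v *)
(* Let [Q_k] be the resolvent [(X_k^T X_k + c)^-1] of the depth-[k] product. Since [tr B^-1] is the
maximum over [Y] of [2 tr Y - tr (Y^T B Y)], taking [Y = Q_k] bounds [tr Q_(k+1)] from below by
[tr Q_k] plus a term linear in [G^T G - 1], with [G] the new layer and coefficients bounded
functions of the older layers; by independence and [E (G^T G) = 1] its expectation vanishes. Hence
[E tr Q_k <= E tr Q_(k+1)], and the convergence of the spectral laws carries this to the limits.

[L_mu(w)] is a nondecreasing function of the Stieltjes transform of [mu] at [s2 / w], and is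
nondecreasing in [w]. Adding independent Gaussian noise to an observation and rotating the Gaussian
pair shows that [1 / mmse - 1 / tau] is nonincreasing in [tau], so [extrinsic_mmse] is nondecreasing.
So [tau |-> L_mu (extrinsic_mmse tau)] is a nondecreasing bounded map, whose largest fixed point is
[sup {tau | tau <= L_mu (extrinsic_mmse tau)}] and therefore grows with [L_mu]. *)

Require Import Defs.
From HB Require Import structures.
From mathcomp Require Import all_boot all_order all_algebra.
From mathcomp Require Import complex.
From mathcomp Require Import all_classical all_reals all_analysis.
From mathcomp Require Import measurable_realfun ring lra.

Set Implicit Arguments.
Unset Strict Implicit.
Unset Printing Implicit Defensive.

Import Order.TTheory GRing.Theory Num.Theory.
Import numFieldNormedType.Exports.

Local Open Scope classical_set_scope.
Local Open Scope ring_scope.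

(** A new layer can decrease [tr Q] for some realizations; only the expectations are ordered.
    Convergence in probability therefore has to be turned into convergence of expectations, which
    works because the normalized trace lies in [[0, 1 / c]]. The free convolutions and the
    Marchenko-Pastur densities supply compact supports and positive means, which keep the
    denominators of [L] positive; the order itself is read off the random matrices. [mmse] is
    defined through an arbitrary version of the conditional expectation. It is first identified with
    the error of an explicit posterior mean; afterwards it is used only as the attained minimum of
    the quadratic error over measurable estimators, so that every bound on it comes from exhibiting
    an estimator. The Stieltjes order compares [L] at [w > 0] only, so a fixed point at which
    [extrinsic_mmse] vanishes is treated apart. *)

Lemma normr_le_1Dsqr (R : realDomainType) (x : R) : `|x| <= 1 + x ^+ 2.
Proof.
rewrite -real_normK ?num_real//; move: `|x| => a.
have : 0 <= (a - 1) ^+ 2 + a ^+ 2 + 1 by rewrite !addr_ge0 ?sqr_ge0.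
by nra.
Qed.

Lemma Rintegral_probability_cst d (T : measurableType d) (R : realType)
  (P : probability T R) (k : R) : \int[P]_w k = k.
Proof.
rewrite Rintegral_cst// -[RHS]mulr1; congr (_ * _).
rewrite -[RHS]/(fine 1%E); congr fine; exact: probability_setT.
Qed.

(** * Gaussian integrals *)

Section density.
Local Open Scope ereal_scope.
Context d (T : measurableType d) (R : realType).
Variables (mu nu : {measure set T -> \bar R}) (p : T -> R).
Hypotheses (mp : measurable_fun setT p) (p0 : forall x, (0 <= p x)%R).
Hypothesis nuE : forall A, measurable A -> nu A = \int[mu]_(x in A) (p x)%:E.

Import HBNNSimple.

(** For a simple function the level sets reduce the claim to [nuE]; monotone convergence does the
    rest. *)
Lemma ge0_integral_density (f : T -> \bar R) :
  measurable_fun setT f -> (forall x, 0 <= f x) ->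
  \int[nu]_x f x = \int[mu]_x (f x * (p x)%:E).
Proof.
move=> mf f0; pose f_ := nnsfun_approx measurableT mf.
have mE : measurable_fun setT (EFin \o p) by exact/measurable_EFinP.
have simple (h : {nnsfun T >-> R}) :
    \int[nu]_x (h x)%:E = \int[mu]_x ((h x)%:E * (p x)%:E).
  under [LHS]eq_integral do rewrite fimfunE -fsumEFin//.
  rewrite [LHS]ge0_integral_fsum//; last 2 first.
    - by move=> r; exact/measurable_EFinP/measurableT_comp.
    - by move=> n x _; rewrite EFinM nnfun_muleindic_ge0.
  under [RHS]eq_integral.
    move=> x xD; rewrite fimfunE -fsumEFin// muleC ge0_mule_fsumr; last first.
      by move=> r; rewrite EFinM nnfun_muleindic_ge0.
    over.
  rewrite [RHS]ge0_integral_fsum//; last 2 first.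
    - move=> r; apply: emeasurable_funM => //.
      exact/measurable_EFinP/measurableT_comp.
    - move=> n x _; apply: mule_ge0; first by rewrite lee_fin.
      by rewrite EFinM nnfun_muleindic_ge0.
  apply: eq_fsbigr => r _; rewrite integralZl_indic_nnsfun//= integral_indic//.
  under [RHS]eq_integral do rewrite EFinM muleCA.
  (* Pulling the value [r] out needs [0 <= r]; a negative value has an empty level set. *)
  have [r0|r0] := ltP r 0%R.
    rewrite preimage_nnfun0// set0I measure0 mule0 integral0_eq// => x _.
    by rewrite indic0 mule0 mule0.
  rewrite ge0_integralZl//=; last 2 first.
    - by apply: emeasurable_funM => //; exact/measurable_EFinP.
    - by move=> x _; rewrite mule_ge0// lee_fin.
  congr (_ * _); rewrite setIT nuE// integral_mkcond/=.
  apply: eq_integral => x _; rewrite patchE indicE.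
  by case: ifPn => _; rewrite ?mule1 ?mule0.
transitivity (limn (fun n => \int[nu]_x (f_ n x)%:E)).
  rewrite -monotone_convergence//=.
  - apply: eq_integral => x _; apply/esym/cvg_lim => //=.
    exact: cvg_nnsfun_approx.
  - by move=> n; exact/measurable_EFinP.
  - by move=> n x _; rewrite lee_fin.
  - by move=> x _ a b ab; rewrite lee_fin//; exact/lefP/nd_nnsfun_approx.
under eq_fun do rewrite simple.
rewrite -monotone_convergence//=.
- apply: eq_integral => x _; apply/cvg_lim => //=.
  apply: cvgeZr => //; exact: cvg_nnsfun_approx.
- by move=> n; apply: emeasurable_funM => //; exact/measurable_EFinP.
- by move=> n x _; rewrite mule_ge0 ?lee_fin.
- move=> x _ a b ab; rewrite lee_pmul ?lee_fin//.
  exact/lefP/nd_nnsfun_approx.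
Qed.

End density.

Section affine.
Context {R : realType}.
Local Notation leb := (@lebesgue_measure R).

Let affine (s t : R) : measurableTypeR R -> measurableTypeR R :=
  fun x => s * x + t.

Let measurable_affine s t : measurable_fun setT (affine s t).
Proof. by apply: measurable_funD => //; exact: measurable_funM. Qed.

(** Lebesgue measure is determined by its values on half-open intervals, so the scaled pushforward
    is only tested there. *)
Lemma lebesgue_measure_affine (s t : R) (s0 : 0 < s) (A : set R) :
  measurable A ->
  leb A = (s%:E * leb ((fun x => s * x + t)%R @^-1` A))%E.
Proof.
pose nu := mscale (NngNum (ltW s0)) (pushforward leb (affine s t)).
move=> mA.
apply: (@lebesgue_measure_unique R (nu (measurable_affine s t))) => // _ [[a b]] _ <-.
rewrite /nu /= /mscale/= /pushforward.
have -> : affine s t @^-1` `]a, b]%classic =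
          `](a - t) / s, (b - t) / s]%classic.
  apply/seteqP; split => x/=; rewrite !in_itv/= ltr_pdivrMr// ler_pdivlMr//
    ltrBlDr lerBrDr (mulrC x)//.
rewrite !lebesgue_measure_itv/= !lte_fin ltr_pM2r ?invr_gt0// ltrD2r.
case: ifP => _; last by rewrite mule0.
by rewrite -!EFinB -EFinM; congr EFin; field; rewrite gt_eqF.
Qed.

Lemma ge0_integral_affine (s t : R) (s0 : 0 < s) (f : R -> \bar R) :
  measurable_fun setT f -> (forall x, 0 <= f x)%E ->
  (\int[leb]_x f x = \int[leb]_x (s%:E * f (s * x + t)%R))%E.
Proof.
move=> mf f0.
pose nu := mscale (NngNum (ltW s0)) (pushforward leb (affine s t)).
transitivity (\int[nu (measurable_affine s t)]_x f x)%E.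
  apply: eq_measure_integral => A mA _.
  exact: lebesgue_measure_affine.
rewrite ge0_integral_mscale//= ge0_integral_pushforward// ge0_integralZl//=.
  by apply: (measurableT_comp mf); exact: measurable_affine.
by rewrite lee_fin ltW.
Qed.

Lemma ge0_integral_opp (f : R -> \bar R) :
  measurable_fun setT f -> (forall x, 0 <= f x)%E ->
  (\int[leb]_x f x = \int[leb]_x f (- x)%R)%E.
Proof.
move=> mf f0.
rewrite -(@ge0_integral_pushforward _ _ (measurableTypeR R) (measurableTypeR R)
  R (-%R : _ -> measurableTypeR R) _ leb setT)//.
apply: eq_measure_integral => // A mA _; exact/esym/lebesgue_measureN.
Qed.

End affine.

Section normal01.
Context {R : realType}.
Local Notation leb := (@lebesgue_measure R).
Local Notation phi := (normal_pdf (0 : R) 1).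
Local Notation N01 := (normal_prob (0 : R) 1).

Lemma normal_pdf01E (x : R) : phi x = normal_peak 1 * expR (- (x ^+ 2 / 2)).
Proof.
rewrite normal_pdfE ?oner_neq0// /normal_fun subr0 expr1n.
by rewrite mulNr.
Qed.

Lemma normal_pdf01_gt0 (x : R) : 0 < phi x.
Proof. by rewrite normal_pdf01E mulr_gt0 ?normal_peak_gt0 ?oner_neq0 ?expR_gt0. Qed.

Lemma normal_pdf01N (x : R) : phi (- x) = phi x.
Proof. by rewrite !normal_pdf01E sqrrN. Qed.

(** The joint density depends on [u ^+ 2 + v ^+ 2] only. The orthogonal map is taken to be a
    reflection, which is its own inverse. *)
Lemma normal_pdf01_rotation (c s u v : R) : c ^+ 2 + s ^+ 2 = 1 ->
  phi (c * u + s * v) * phi (s * u - c * v) = phi u * phi v.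
Proof.
move=> cs; rewrite !normal_pdf01E mulrACA [RHS]mulrACA -!expRD.
congr (_ * expR _).
transitivity (- ((c ^+ 2 + s ^+ 2) * (u ^+ 2 + v ^+ 2) / 2)); first by field.
by rewrite cs; field.
Qed.

Lemma ge0_integral_normal01 (f : R -> \bar R) :
  measurable_fun setT f -> (forall x, 0 <= f x)%E ->
  (\int[N01]_x f x = \int[leb]_x (f x * (phi x)%:E))%E.
Proof.
move=> mf f0; apply: ge0_integral_density => //.
  exact: measurable_normal_pdf.
by move=> x; exact: normal_pdf_ge0.
Qed.

Let is_derive_phi (x : R) : is_derive x 1 (fun t => - phi t) (x * phi x).
Proof.
rewrite (_ : (fun t => _) = (fun t => - normal_peak 1 * expR (- (t ^+ 2 / 2)))); last first.
  by apply/funext => t; rewrite normal_pdf01E mulNr.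
rewrite normal_pdf01E; apply: is_derive_eq.
by rewrite /GRing.scale/=; field.
Qed.

Lemma integral_even (h : R -> R) : measurable_fun setT h ->
  (forall x, 0 <= h x) -> (forall x, h (- x) = h x) ->
  (\int[leb]_x (h x)%:E =
   \int[leb]_(x in `[0%R, +oo[) (h x)%:E +
   \int[leb]_(x in `[0%R, +oo[) (h x)%:E)%E.
Proof.
move=> mh h0 hN.
have mE : measurable_fun setT (EFin \o h) by exact/measurable_EFinP.
rewrite -{1}(setvU `[0, +oo[%classic) ge0_integral_setU//=; last 4 first.
  exact: measurableC.
  by rewrite setvU.
  by move=> x _; rewrite lee_fin.
  by rewrite disj_set2E setICl.
rewrite setCitvr; congr (_ + _)%E.
rewrite integral_itv_bndo_bndc; last exact: measurable_funS mE.
rewrite (@ge0_integration_by_substitution0 R (EFin \o h))//.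
by apply: eq_integral => x _ /=; rewrite hN.
Qed.

Let cvg_phi : - phi x @[x --> +oo] --> (0 : R).
Proof.
rewrite -[X in _ --> X]oppr0; apply: cvgN.
rewrite (_ : phi = fun x => normal_peak 1 * expR (- (x ^+ 2 / 2))); last first.
  by apply/funext => x; exact: normal_pdf01E.
rewrite -[X in _ --> X](mulr0 (normal_peak 1)); apply: cvgM; first exact: cvg_cst.
apply: (cvg_comp (fun x => x ^+ 2 / 2) (fun x => expR (- x))).
  apply: gt0_cvgMly; last exact: cvgr_expr2.
  by rewrite invr_gt0.
exact: cvgr_expR.
Qed.

Let integral_tail (x : R) : 0 <= x ->
  (\int[leb]_(t in `[x, +oo[) (t * phi t)%:E = (phi x)%:E)%E.
Proof.
move=> x0; rewrite (@ge0_continuous_FTC2y _ _ (fun t => - phi t) _ 0).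
- by rewrite sub0e -EFinN opprK.
- by move=> t xt; rewrite mulr_ge0 ?normal_pdf_ge0// (le_trans x0).
- apply: continuous_subspaceT => t; apply: continuousM; first exact: cvg_id.
  by apply: continuous_normal_pdf; exact: oner_neq0.
- exact: cvg_phi.
- by move=> t _; exact: ex_derive.
- apply: cvg_at_right_filter; apply: continuousN.
  by apply: continuous_normal_pdf; exact: oner_neq0.
- by move=> t _; rewrite derive1E; apply: derive_val.
Qed.

(* The second moment is [2 \int_(t >= 0) \int_(0 <= x <= t) t phi(t)]; integrating in [t] first
   gives [2 \int_(x >= 0) phi(x) = 1]. *)
Lemma integral_normal01_sqr : (\int[N01]_x (x ^+ 2)%:E = 1)%E.
Proof.
have mphi : measurable_fun setT phi by exact: measurable_normal_pdf.
rewrite ge0_integral_normal01//; last 2 first.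
  exact/measurable_EFinP.
  by move=> x; rewrite lee_fin sqr_ge0.
under eq_integral do rewrite -EFinM.
rewrite integral_even; last 3 first.
  by apply: measurable_funM => //.
  by move=> x; rewrite mulr_ge0 ?sqr_ge0 ?normal_pdf_ge0.
  by move=> x; rewrite sqrrN normal_pdf01N.
rewrite -(integral_normal_pdf (0 : R) 1) integral_even//; last 2 first.
  by move=> x; exact: normal_pdf_ge0.
  exact: normal_pdf01N.
set I1 := (X in (X + X)%E = _); set I2 := (X in _ = (X + X)%E).
suff -> : I1 = I2 by [].
pose F (z : R * R) :=
  (if (0 <= z.1) && (z.1 <= z.2) then z.2 * phi z.2 else 0)%:E.
have mF : measurable_fun setT F.
  apply/measurable_EFinP; apply: measurable_fun_ifT => //.
    by apply: measurable_and; exact: measurable_fun_ler.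
  apply: measurable_funM => //.
  exact: (measurableT_comp mphi).
have F0 z : (0 <= F z)%E.
  rewrite lee_fin; case: ifP => // /andP[z1 z12].
  by rewrite mulr_ge0 ?normal_pdf_ge0// (le_trans z1).
transitivity (\int[leb]_t \int[leb]_x F (x, t))%E.
  rewrite [LHS]integral_mkcond; apply: eq_integral => t _.
  rewrite patchE; case: ifPn => [|].
    rewrite inE/= in_itv/= andbT => t0.
    transitivity (\int[leb]_(x in `[0%R, t]) (cst (t * phi t)%:E) x)%E.
      rewrite integral_cst//= lebesgue_measure_itv/= lte_fin.
      have [t_gt0|t_le0] := ltP 0 t.
        by rewrite sube0 -EFinM; congr EFin; rewrite expr2; ring.
      have -> : t = 0 by apply/eqP; rewrite eq_le t_le0.
      by rewrite expr0n mule0 mul0r.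
    rewrite [LHS]integral_mkcond; apply: eq_integral => x _.
    by rewrite patchE mem_setE in_itv/= /F/=; case: ifP.
  rewrite notin_setE/= in_itv/= andbT => /negP; rewrite -ltNge => t0.
  rewrite integral0_eq// => x _; rewrite /F/=.
  case: ifP => // /andP[x0 xt]; have := lt_le_trans t0 x0.
  by rewrite ltNge xt.
rewrite -(fubini_tonelli (m1 := leb) (m2 := leb) F)// [RHS]integral_mkcond.
apply: eq_integral => x _; rewrite patchE; case: ifPn => [|].
  rewrite inE/= in_itv/= andbT => x0.
  rewrite -integral_tail// [RHS]integral_mkcond; apply: eq_integral => t _.
  by rewrite /F/= patchE mem_setE in_itv/= andbT x0/=; case: ifPn.
rewrite notin_setE/= in_itv/= andbT => /negP/negbTE x0.
by rewrite integral0_eq// => t _; rewrite /F/= x0.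
Qed.

End normal01.

Section normal01_integrals.
Context {R : realType}.
Local Notation leb := (@lebesgue_measure R).
Local Notation phi := (normal_pdf (0 : R) 1).
Local Notation N01 := (normal_prob (0 : R) 1).

Let mphi : measurable_fun setT phi. Proof. exact: measurable_normal_pdf. Qed.

Let mphiE : measurable_fun setT (EFin \o phi).
Proof. exact/measurable_EFinP. Qed.

Let phi0 x : (0 <= (phi x)%:E)%E.
Proof. by rewrite lee_fin normal_pdf_ge0. Qed.

Lemma ge0_integral_normal01N (f : R -> \bar R) :
  measurable_fun setT f -> (forall x, 0 <= f x)%E ->
  (\int[N01]_x f x = \int[N01]_x f (- x)%R)%E.
Proof.
move=> mf f0; rewrite !ge0_integral_normal01//; last first.
  exact: measurableT_comp.
rewrite ge0_integral_opp.
- by apply: eq_integral => x _; rewrite normal_pdf01N.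
- exact: emeasurable_funM.
- by move=> x; exact: mule_ge0.
Qed.

(** Adding the integral to its mirror image under [x |-> - x] cancels the cross term pointwise, so
    that only nonnegative integrands occur and no integrability has to be checked. *)
Lemma integral_normal01_affine_sqr (a b : R) :
  (\int[N01]_x ((a + b * x) ^+ 2)%:E = (a ^+ 2 + b ^+ 2)%:E)%E.
Proof.
have m1 c : measurable_fun setT (fun x : R => ((a + c * x) ^+ 2)%:E).
  apply/measurable_EFinP; apply: measurable_funX; exact: measurable_funD.
have sqr2_ge0 (x : R) : 0 <= 2 * x ^+ 2 by apply: mulr_ge0 => //; exact: sqr_ge0.
have p1 c x : (0 <= ((a + c * x) ^+ 2)%:E)%E by rewrite lee_fin sqr_ge0.
have half : (\int[N01]_x ((a + b * x) ^+ 2)%:E =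
             \int[N01]_x ((a + (- b) * x) ^+ 2)%:E)%E.
  rewrite ge0_integral_normal01N//.
  by apply: eq_integral => x _; rewrite mulrN mulNr.
have : (\int[N01]_x ((a + b * x) ^+ 2)%:E +
        \int[N01]_x ((a + b * x) ^+ 2)%:E = (2 * (a ^+ 2 + b ^+ 2))%:E)%E.
  rewrite {2}half -ge0_integralD//; last 2 first.
    exact: m1.
    exact: m1.
  transitivity (\int[N01]_x ((2 * a ^+ 2)%:E + (2 * b ^+ 2)%:E * (x ^+ 2)%:E))%E.
    by apply: eq_integral => x _; rewrite -EFinM -!EFinD; congr EFin; ring.
  rewrite ge0_integralD//=; last 3 first.
    by move=> _ _; rewrite lee_fin; exact: sqr2_ge0.
    by move=> x _; rewrite -EFinM lee_fin mulr_ge0 ?sqr_ge0 ?sqr2_ge0.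
    by apply: emeasurable_funM => //; exact/measurable_EFinP.
  rewrite integral_cst//= ge0_integralZl//=; last 3 first.
    exact/measurable_EFinP.
    by move=> x _; rewrite lee_fin sqr_ge0.
    by rewrite lee_fin sqr2_ge0.
  rewrite probability_setT integral_normal01_sqr !mule1.
  by rewrite -EFinD; congr EFin; ring.
(* Nonnegativity excludes [-oo] and the finite sum excludes [+oo], so the doubled equation can be
   halved. *)
have : (0 <= \int[N01]_x ((a + b * x) ^+ 2)%:E)%E by exact: integral_ge0.
move: (\int[N01]_x ((a + b * x) ^+ 2)%:E)%E => [r| |]//= _.
by rewrite -EFinD => -[rr]; congr EFin; lra.
Qed.

(** Since [s] is positive, one variable can be substituted at a time, which avoids a change of
    variables in the plane. *)
Lemma normal01_rotation (F : R -> R -> \bar R) (c s : R) :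
  0 < s -> c ^+ 2 + s ^+ 2 = 1 ->
  measurable_fun setT (fun z : R * R => F z.1 z.2) ->
  (forall x y, 0 <= F x y)%E ->
  (\int[N01]_z \int[N01]_w F (c * z + s * w)%R (s * z - c * w)%R =
   \int[N01]_u \int[N01]_v F u v)%E.
Proof.
move=> s0 cs mF F0.
have sn0 : s != 0 by rewrite gt_eqF.
have m1 : measurable_fun setT (fun z : R * R => z.1) by exact: measurable_fst.
have m2 : measurable_fun setT (fun z : R * R => z.2) by exact: measurable_snd.
have mK (G : R -> R -> \bar R) :
    measurable_fun setT (fun z : R * R => G z.1 z.2) ->
    (forall x, measurable_fun setT (G x)) * (forall y, measurable_fun setT (G ^~ y)).
  move=> mG; split => x.
    exact: (measurableT_comp mG (measurable_pair1 x)).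
  exact: (measurableT_comp mG (measurable_pair2 x)).
have mFc (f g : R * R -> R) : measurable_fun setT f -> measurable_fun setT g ->
    measurable_fun setT (fun z => F (f z) (g z)).
  move=> mf mg.
  exact: (measurableT_comp mF (measurable_fun_pair mf mg)).
have mlin (a b : R) : measurable_fun setT (fun z : R * R => a * z.1 + b * z.2).
  by apply: measurable_funD; exact: measurable_funM.
have double (G : R -> R -> \bar R) :
    measurable_fun setT (fun z : R * R => G z.1 z.2) ->
    (forall x y, 0 <= G x y)%E ->
    (\int[N01]_z \int[N01]_w G z w =
     \int[leb]_z \int[leb]_w (G z w * (phi z * phi w)%:E))%E.
  move=> mG G0.
  have mGz z : measurable_fun setT (G z) by exact: (mK _ mG).1.
  rewrite ge0_integral_normal01; last 2 first.
  - apply: (measurable_fun_fubini_tonelli_F (m2 := N01) (fun z => G z.1 z.2)) => //.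
  - by move=> x; apply: integral_ge0.
  apply: eq_integral => z _; rewrite ge0_integral_normal01//.
  rewrite -ge0_integralZr//.
  - by apply: eq_integral => w _; rewrite -muleA -EFinM (mulrC (phi w)).
  - apply: emeasurable_funM; [exact: mGz | exact: mphiE].
  - by move=> x _; exact: mule_ge0.
rewrite [LHS]double; last 2 first.
- apply: mFc; first exact: mlin.
  by under eq_fun do rewrite -mulNr; exact: mlin.
- by move=> x y; exact: F0.
rewrite [RHS](double F mF F0).
(* Substitute [w = (u - c z) / s], exchange the integrals, then substitute [z = s v + c u]. *)
pose K1 (u z : R) := (s^-1%:E *
  (F u (s * z - c * ((u - c * z) / s))%R * (phi z * phi ((u - c * z) / s))%:E))%E.
have mK1 : measurable_fun setT (fun z : R * R => K1 z.1 z.2).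
  have mq : measurable_fun setT (fun z : R * R => (z.1 - c * z.2) / s).
    apply: measurable_funM => //; apply: measurable_funB => //.
    exact: measurable_funM.
  apply: emeasurable_funM => //; apply: emeasurable_funM.
    apply: mFc => //; apply: measurable_funB; exact: measurable_funM.
  apply/measurable_EFinP; apply: measurable_funM; exact: (measurableT_comp mphi).
have K10 u z : (0 <= K1 u z)%E.
  rewrite /K1 mule_ge0//; first by rewrite lee_fin invr_ge0 ltW.
  by rewrite mule_ge0// lee_fin mulr_ge0// normal_pdf_ge0.
pose dens (z w : R) :=
  (F (c * z + s * w)%R (s * z - c * w)%R * (phi z * phi w)%:E)%E.
have mdens : measurable_fun setT (fun z : R * R =>
    F (c * z.1 + s * z.2)%R (s * z.1 - c * z.2)%R * (phi z.1 * phi z.2)%:E)%E.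
  apply: emeasurable_funM.
    apply: mFc; first exact: mlin.
    by under eq_fun do rewrite -mulNr; exact: mlin.
  apply/measurable_EFinP; apply: measurable_funM; exact: (measurableT_comp mphi).
have dens0 z w : (0 <= F (c * z + s * w)%R (s * z - c * w)%R * (phi z * phi w)%:E)%E.
  by rewrite mule_ge0// lee_fin mulr_ge0// normal_pdf_ge0.
transitivity (\int[leb]_z \int[leb]_u K1 u z)%E.
  apply: eq_integral => z _.
  have si0 : 0 < s^-1 by rewrite invr_gt0.
  rewrite (ge0_integral_affine (- (c * z) / s) si0 ((mK dens mdens).1 z) (dens0 z)).
  apply: eq_integral => u _; rewrite /K1.
  have -> : s^-1 * u + - (c * z) / s = (u - c * z) / s by field.
  rewrite /dens.
  by have -> : c * z + s * ((u - c * z) / s) = u by field.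
have K1ge0 (z : R * R) : (0 <= K1 z.1 z.2)%E by exact: K10.
rewrite -(fubini_tonelli (m1 := leb) (m2 := leb) _ mK1 K1ge0).
apply: eq_integral => u _.
rewrite (ge0_integral_affine (c * u) s0 ((mK K1 mK1).1 u) (K10 u)).
apply: eq_integral => v _; rewrite /K1 muleA -EFinM divff// mul1e.
rewrite -(normal_pdf01_rotation u v cs).
have -> : (u - c * (s * v + c * u)) / s = s * u - c * v.
  transitivity ((u * (1 - c ^+ 2) - c * s * v) / s); first by congr (_ / s); ring.
  by rewrite -cs; field.
have -> : s * (s * v + c * u) - c * (s * u - c * v) = v.
  by rewrite -[RHS]mul1r -cs; ring.
by congr (F _ _ * (phi _ * _)%:E)%E; rewrite addrC.
Qed.

End normal01_integrals.

Section centered_normal.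
Context (R : realType) (s : R).
Hypothesis s0 : 0 < s.
Local Notation N01 := (normal_prob (0 : R) 1).

Lemma ge0_integral_normal0 (f : R -> \bar R) :
  measurable_fun setT f -> (forall x, 0 <= f x)%E ->
  (\int[normal_prob 0 s]_x f x = \int[N01]_x f (s * x)%R)%E.
Proof.
move=> mf f0.
have pdf0 x : 0 <= normal_pdf 0 s x by exact: normal_pdf_ge0.
have -> : (\int[normal_prob 0 s]_x f x =
           \int[lebesgue_measure]_x (f x * (normal_pdf 0 s x)%:E))%E.
  by apply: ge0_integral_density => //; exact: measurable_normal_pdf.
have mfp : measurable_fun setT (fun x => f x * (normal_pdf 0 s x)%:E)%E.
  by apply: emeasurable_funM => //; apply/measurable_EFinP; exact: measurable_normal_pdf.
have fp0 x : (0 <= f x * (normal_pdf 0 s x)%:E)%E by rewrite mule_ge0// lee_fin.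
rewrite (ge0_integral_affine 0 s0 mfp fp0).
have mfs : measurable_fun setT (fun x => f (s * x)%R).
  by apply: (measurableT_comp mf); exact: measurable_funM.
rewrite (ge0_integral_normal01 mfs (fun x => f0 _)).
apply: eq_integral => x _; rewrite addr0 muleCA -EFinM; congr (_ * _%:E)%E.
rewrite normal_pdf01E normal_pdfE ?gt_eqF// /normal_fun subr0 mulrA; congr (_ * expR _).
  rewrite /normal_peak -mulrnAr sqrtrM ?sqr_ge0// sqrtr_sqr gtr0_norm//.
  rewrite invfM mulrA divff ?gt_eqF// mul1r.
  by rewrite expr1n mul1r.
by field; rewrite gt_eqF.
Qed.

Context d (T : measurableType d) (P : probability T R) (X : {RV P >-> R}).
Hypothesis XN : forall A, measurable A -> distribution P X A = normal_prob 0 s A.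

Let ge0_integral_normal_rv (f : R -> \bar R) :
  measurable_fun setT f -> (forall x, 0 <= f x)%E ->
  (\int[P]_w f (X w) = \int[N01]_x f (s * x)%R)%E.
Proof.
move=> mf f0; rewrite -ge0_integral_normal0//.
have mX : measurable_fun setT (X : T -> measurableTypeR R) by exact: (@measurable_funPT _ _ _ _ X).
have f0' : {in [set: measurableTypeR R], forall y, 0 <= f y}%E by move=> y _.
have E := @ge0_integral_pushforward _ _ T (measurableTypeR R) R X mX P setT f
  measurableT mf f0'.
rewrite preimage_setT in E; rewrite -[LHS]E.
by apply: eq_measure_integral => A mA _; exact: XN.
Qed.

Lemma normal_rv_sqr : (\int[P]_w (X w ^+ 2)%:E = (s ^+ 2)%:E)%E.
Proof.
rewrite (@ge0_integral_normal_rv (fun x => (x ^+ 2)%:E)).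
- have <- : (0 : R) ^+ 2 + s ^+ 2 = s ^+ 2 by rewrite expr0n add0r.
  rewrite -integral_normal01_affine_sqr.
  by apply: eq_integral => x _; rewrite add0r.
- by apply/measurable_EFinP; exact: measurable_funX.
- by move=> x; rewrite lee_fin sqr_ge0.
Qed.

Lemma normal_rv_sqr_integrable : P.-integrable setT (EFin \o (fun w => X w ^+ 2)).
Proof.
apply/integrableP; split.
  by apply/measurable_EFinP; exact: measurable_funX.
under eq_integral do rewrite gee0_abs ?lee_fin ?sqr_ge0//.
by rewrite normal_rv_sqr ltry.
Qed.

Lemma normal_rv_integrable : P.-integrable setT (EFin \o X).
Proof.
have i1 : P.-integrable setT (EFin \o (fun _ : T => 1 : R)).
  exact: finite_measure_integrable_cst.
apply: le_integrable (integrableD measurableT i1 normal_rv_sqr_integrable) => //.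
  exact/measurable_EFinP.
by move=> w _ /=; rewrite lee_fin [leRHS]ger0_norm ?addr_ge0 ?sqr_ge0// normr_le_1Dsqr.
Qed.

(** By symmetry the positive and negative parts have the same integral, which is finite because the
    second moment is. *)
Lemma normal_rv_mean : \int[P]_w X w = 0.
Proof.
have mpos : measurable_fun setT (fun x : R => (Num.max x 0)%:E).
  by apply/measurable_EFinP; exact: measurable_maxr.
have mneg : measurable_fun setT (fun x : R => (Num.max (- x) 0)%:E).
  by apply/measurable_EFinP; apply: measurable_maxr => //; exact: measurable_funN.
have max0 (x : R) : (0 <= (Num.max x 0)%:E)%E by rewrite lee_fin le_max lexx orbT.
have posE : (\int[P]_w (fun w => (X w)%:E)^\+ w = \int[P]_w (Num.max (X w) 0)%:E)%E.
  by apply: eq_integral => w _; rewrite funeposE -EFin_max.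
have negE : (\int[P]_w (fun w => (X w)%:E)^\- w = \int[P]_w (Num.max (- X w) 0)%:E)%E.
  by apply: eq_integral => w _; rewrite funenegE -EFinN -EFin_max.
have nfin : (\int[P]_w (fun w => (X w)%:E)^\- w \is a fin_num)%E.
  apply: (integrable_fin_num measurableT).
  exact: (integrable_funeneg measurableT normal_rv_integrable).
suff pn : (\int[P]_w (fun w => (X w)%:E)^\+ w = \int[P]_w (fun w => (X w)%:E)^\- w)%E.
  by rewrite /Rintegral integralE pn subee.
rewrite posE negE (ge0_integral_normal_rv mpos)// (ge0_integral_normal_rv mneg)//.
rewrite ge0_integral_normal01N//; last first.
  by apply: (measurableT_comp mpos); exact: measurable_funM.
by apply: eq_integral => x _; rewrite mulrN.
Qed.

End centered_normal.

(* Inversion is not continuous at 0; the expression below agrees with it there thanks to the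
   convention [0^-1 = 0]. *)
Lemma measurable_invr (R : realType) : measurable_fun setT (@GRing.inv R).
Proof.
rewrite (_ : GRing.inv = fun x : R => x * expR (- ln (x ^+ 2))).
  apply: measurable_funM => //; apply: (measurableT_comp (@measurable_expR R)).
  apply: measurable_funN; apply: (measurableT_comp (@measurable_ln R)).
  exact: measurable_funX.
apply/funext => x; have [->|x0] := eqVneq x 0; first by rewrite invr0 mul0r.
by rewrite expRN lnK ?posrE ?exprn_even_gt0// expr2 invfM mulrA divff// mul1r.
Qed.

Lemma measurable_funV d (T : measurableType d) (R : realType) (f : T -> R) :
  measurable_fun setT f -> measurable_fun setT (fun x => (f x)^-1).
Proof. by move=> mf; exact: (measurableT_comp (@measurable_invr R) mf). Qed.

(** * Weighted means and least squares *)

Section weighted_mean.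
Context d (T : measurableType d) (R : realType) (mu : probability T R).
Variables (X k : T -> R) (C : R).
Hypotheses (mX : measurable_fun setT X) (mk : measurable_fun setT k).
Hypotheses (k0 : forall x, 0 < k x) (kC : forall x, k x <= C).
Hypothesis X2 : (\int[mu]_x (X x ^+ 2)%:E < +oo)%E.

(* Split into positive and negative parts so that Tonelli yields the measurability in a parameter
   of [k]. *)
Definition weighted_mean : R :=
  (\int[mu]_x (Num.max (X x) 0 * k x) - \int[mu]_x (Num.max (- X x) 0 * k x)) /
  \int[mu]_x k x.

Let intX2 : mu.-integrable setT (fun x => (X x ^+ 2)%:E).
Proof.
apply/integrableP; split; first by apply/measurable_EFinP; exact: measurable_funX.
by under eq_integral do rewrite gee0_abs ?lee_fin ?sqr_ge0//.
Qed.

Let int1 : mu.-integrable setT (fun x => (1 : R)%:E).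
Proof. exact: finite_measure_integrable_cst. Qed.

Let intk (f : T -> R) : measurable_fun setT f ->
  (forall x, `|f x| <= 1 + X x ^+ 2) -> mu.-integrable setT (EFin \o (fun x => f x * k x)).
Proof.
move=> mf fX.
apply: (@le_integrable _ _ _ mu setT measurableT _ (fun x => (C%:E * (1 + X x ^+ 2)%:E)%E)).
- by apply/measurable_EFinP; exact: measurable_funM.
- move=> x _; rewrite /= lee_fin !normrM (gtr0_norm (k0 x)).
  rewrite [leRHS]mulrC ler_pM// ?(ltW (k0 x))//.
    by rewrite (le_trans (fX x))// ler_norm.
  by rewrite (le_trans (kC x))// ler_norm.
- apply: integrableZl => //.
  rewrite (_ : (fun x => _) = (fun x => (1%:E + (X x ^+ 2)%:E)%E)).
    exact: integrableD.
  by apply/funext => x; rewrite -EFinD.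
Qed.

Let X1 x : `|X x| <= 1 + X x ^+ 2. Proof. exact: normr_le_1Dsqr. Qed.

Local Notation D := (\int[mu]_x k x).
Local Notation N := (\int[mu]_x (X x * k x)).
Local Notation S := (\int[mu]_x (X x ^+ 2 * k x)).

Let ik : mu.-integrable setT (EFin \o k).
Proof.
have := @intk (cst 1) (measurable_cst _); rewrite (_ : (fun x => _) = k).
  by apply=> x; rewrite normr1 lerDl sqr_ge0.
by apply/funext => x; rewrite mul1r.
Qed.

Let iXk : mu.-integrable setT (EFin \o (fun x => X x * k x)).
Proof. exact: intk. Qed.

Let iX2k : mu.-integrable setT (EFin \o (fun x => X x ^+ 2 * k x)).
Proof.
apply: intk; first exact: measurable_funX.
by move=> x; rewrite ger0_norm ?sqr_ge0// lerDr.
Qed.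

(** With zero integral, the everywhere positive [k] would vanish almost everywhere, against the
    total mass 1. *)
Lemma weight_gt0 : 0 < D.
Proof.
rewrite lt_neqAle Rintegral_ge0 ?andbT; last by move=> x _; rewrite ltW.
apply/eqP => D0.
have D0E : (\int[mu]_x `|(k x)%:E| = 0)%E.
  under eq_integral do rewrite gee0_abs ?lee_fin ?(ltW (k0 _))//.
  by rewrite -[LHS]fineK ?integrable_fin_num// -/(Rintegral mu setT k) -D0.
have := @ae_eq_integral_abs _ _ _ mu setT measurableT (EFin \o k)
  (measurable_int _ ik).
move=> [/(_ D0E)[A [mA A0 subA]] _].
have : (mu setT <= 0)%E.
  rewrite -A0 le_measure ?inE// => x _; apply: subA => /= /(_ I) /eqP.
  by rewrite /cst/= eqe gt_eqF.
by rewrite probability_setT lee_fin ler10.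
Qed.

Let Npm : \int[mu]_x (Num.max (X x) 0 * k x) - \int[mu]_x (Num.max (- X x) 0 * k x) = N.
Proof.
rewrite -RintegralB//.
- apply: eq_Rintegral => x _; rewrite -mulrBl; congr (_ * _).
  case: (leP (X x) 0) => x0; case: (leP (- X x) 0); lra.
- apply: intk; first exact: measurable_maxr.
  move=> x; apply: le_trans (X1 x); rewrite ger0_norm ?le_max ?lexx ?orbT//.
  by rewrite ge_max normr_ge0 ler_norm.
- apply: intk; first by apply: measurable_maxr => //; exact: measurable_funN.
  move=> x; apply: le_trans (X1 x); rewrite ger0_norm ?le_max ?lexx ?orbT//.
  by rewrite ge_max normr_ge0 -normrN ler_norm.
Qed.

Lemma weighted_meanE : weighted_mean = N / D.
Proof. by rewrite /weighted_mean Npm. Qed.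

Lemma weighted_quadratic (g : R) :
  (\int[mu]_x ((g - X x) ^+ 2 * k x)%:E = (g ^+ 2 * D - 2 * g * N + S)%:E)%E.
Proof.
transitivity (\int[mu]_x (g ^+ 2 * k x - 2 * g * (X x * k x) + X x ^+ 2 * k x)%:E)%E.
  by apply: eq_integral => x _; congr EFin; ring.
have i1 : mu.-integrable setT (EFin \o (fun x => g ^+ 2 * k x)).
  exact: (integrableZl measurableT (g ^+ 2) ik).
have i2 : mu.-integrable setT (EFin \o (fun x => 2 * g * (X x * k x))).
  exact: (integrableZl measurableT (2 * g) iXk).
have i3 : mu.-integrable setT (EFin \o (fun x => g ^+ 2 * k x - 2 * g * (X x * k x))).
  exact: (integrableB measurableT i1 i2).
rewrite -[LHS]fineK; last by apply: integrable_fin_num => //; exact: (integrableD measurableT i3 iX2k).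
congr EFin; rewrite -/(Rintegral mu setT _) RintegralD// RintegralB//.
by rewrite !RintegralZl.
Qed.

(** The error is a quadratic polynomial in [g] with leading coefficient [D > 0] and vertex
    [N / D]. *)
Lemma weighted_mean_min (g : R) :
  (\int[mu]_x ((weighted_mean - X x) ^+ 2 * k x)%:E <=
   \int[mu]_x ((g - X x) ^+ 2 * k x)%:E)%E.
Proof.
rewrite !weighted_quadratic lee_fin lerD2r -subr_ge0.
rewrite [leRHS](_ : _ = D * (g - weighted_mean) ^+ 2).
  by rewrite mulr_ge0 ?sqr_ge0// ltW// weight_gt0.
by rewrite weighted_meanE; field; rewrite gt_eqF// weight_gt0.
Qed.

(** This is the vanishing of the mean of [(weighted_mean - X) * k], with the two signs apart so that
    both sides can later be integrated in a parameter by Tonelli. *)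
Lemma weighted_mean_centered :
  (\int[mu]_x (Num.max (weighted_mean - X x) 0 * k x)%:E =
   \int[mu]_x (Num.max (X x - weighted_mean) 0 * k x)%:E)%E.
Proof.
set h := weighted_mean.
have mh : measurable_fun setT (fun x => h - X x) by exact: measurable_funB.
have mh' : measurable_fun setT (fun x => X x - h) by exact: measurable_funB.
have ihk : mu.-integrable setT (EFin \o (fun x => (h - X x) * k x)).
  rewrite (_ : (fun x => _) = (fun x => h * k x - X x * k x)).
    exact: (integrableB measurableT (integrableZl measurableT h ik) iXk).
  by apply/funext => x; rewrite mulrBl.
have ip : mu.-integrable setT (EFin \o (fun x => Num.max (h - X x) 0 * k x)).
  apply: le_integrable ihk => //.
    apply/measurable_EFinP; apply: measurable_funM => //; exact: measurable_maxr.
  move=> x _; rewrite /= lee_fin !normrM ler_pM2r ?normr_gt0 ?gt_eqF//.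
  by rewrite ger0_norm ?le_max ?lexx ?orbT// ge_max normr_ge0 ler_norm.
have im : mu.-integrable setT (EFin \o (fun x => Num.max (X x - h) 0 * k x)).
  apply: le_integrable ihk => //.
    apply/measurable_EFinP; apply: measurable_funM => //; exact: measurable_maxr.
  move=> x _; rewrite /= lee_fin !normrM ler_pM2r ?normr_gt0 ?gt_eqF//.
  by rewrite ger0_norm ?le_max ?lexx ?orbT// ge_max normr_ge0 distrC ler_norm.
rewrite -[LHS]fineK ?integrable_fin_num// -[RHS]fineK ?integrable_fin_num//.
congr EFin; apply/eqP; rewrite -subr_eq0 -!/(Rintegral mu setT _) -RintegralB//.
rewrite (@eq_Rintegral _ _ _ mu setT (fun x => h * k x - X x * k x)); last first.
  move=> x _; rewrite -!mulrBl; congr (_ * _).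
  case: (leP (h - X x) 0) => x0; case: (leP (X x - h) 0); lra.
rewrite RintegralB//; last exact: (integrableZl measurableT h ik).
rewrite RintegralZl// /h weighted_meanE divfK ?subrr//.
by rewrite gt_eqF// weight_gt0.
Qed.

End weighted_mean.

(** * Monotonicity of the mean square error in the noise level *)

Section mmse.
Context (R : realType) (Pi : probability (measurableTypeR R) R) (tau : R).
Hypothesis Pi2 : finite_second_moment Pi.
Hypothesis tau0 : 0 < tau.
Local Notation leb := (@lebesgue_measure R).
Local Notation phi := (normal_pdf (0 : R) 1).
Local Notation N01 := (normal_prob (0 : R) 1).
Local Notation s := (Num.sqrt tau).

Let P := (Pi \x N01)%E.
Let B := fun w : R * R => w.1.
Let Y := fun w : R * R => w.1 + s * w.2.
(** The density of the noise [sqrt tau * Z]; given [B = b], the observation has density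
    [q (y - b)]. *)
Let q (x : R) := s^-1 * phi (x / s).

Let s0 : 0 < s. Proof. by rewrite sqrtr_gt0. Qed.

Let mq : measurable_fun setT q.
Proof.
apply: measurable_funM => //.
apply: (measurableT_comp (measurable_normal_pdf 0 1)).
exact: measurable_funM.
Qed.

Let q_gt0 x : 0 < q x.
Proof. by rewrite /q mulr_gt0 ?invr_gt0 ?normal_pdf01_gt0. Qed.

Let q_le x : q x <= s^-1 * normal_peak 1.
Proof. by rewrite ler_pM2l ?invr_gt0// normal_pdf_ub ?oner_neq0. Qed.

Let mB : measurable_fun setT B. Proof. exact: measurable_fst. Qed.

Let mY : measurable_fun setT Y.
Proof.
apply: measurable_funD; first exact: measurable_fst.
by apply: measurable_funM => //; exact: measurable_snd.
Qed.

Let mqY : measurable_fun setT (fun z : R * R => q (z.1 - z.2)).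
Proof.
apply: (measurableT_comp mq).
by apply: measurable_funB; [exact: measurable_fst|exact: measurable_snd].
Qed.

(** Disintegration along the observation: the substitution [z = (y - b) / s] in the noise, then
    Tonelli to bring [y] outside. *)
Let integral_channel (F : R -> R -> \bar R) :
  measurable_fun setT (fun z : R * R => F z.1 z.2) ->
  (forall b y, 0 <= F b y)%E ->
  (\int[P]_w F (B w) (Y w) =
   \int[leb]_y \int[Pi]_b (F b y * (q (y - b))%:E))%E.
Proof.
move=> mF F0.
have mFY : measurable_fun setT (fun w => F (B w) (Y w)).
  exact: (measurableT_comp mF (measurable_fun_pair mB mY)).
have F0Y w : (0 <= F (B w) (Y w))%E by exact: F0.
pose K (b y : R) := (F b y * (q (y - b))%:E)%E.
have mK : measurable_fun setT (fun z : R * R => K z.1 z.2).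
  apply: emeasurable_funM => //; apply/measurable_EFinP.
  apply: (measurableT_comp mq).
  by apply: measurable_funB; [exact: measurable_snd|exact: measurable_fst].
have K0 (z : R * R) : (0 <= K z.1 z.2)%E.
  by rewrite mule_ge0// lee_fin ltW.
rewrite (fubini_tonelli1 (m1 := Pi) (m2 := N01) _ mFY F0Y).
rewrite -(fubini_tonelli (m1 := Pi) (m2 := leb) _ mK K0).
apply: eq_integral => b _; rewrite /fubini_F.
have mb : measurable_fun setT (fun z : R => F b (b + s * z)).
  exact: (measurableT_comp mFY (measurable_pair1 b)).
rewrite (ge0_integral_normal01 mb)//.
have mdens : measurable_fun setT (fun z => F b (b + s * z)%R * (phi z)%:E)%E.
  apply: emeasurable_funM => //; apply/measurable_EFinP.
  exact: measurable_normal_pdf.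
have dens0 z : (0 <= F b (b + s * z)%R * (phi z)%:E)%E.
  by rewrite mule_ge0// lee_fin normal_pdf_ge0.
have si0 : 0 < s^-1 by rewrite invr_gt0.
rewrite (ge0_integral_affine (- b / s) si0 mdens dens0).
apply: eq_integral => y _.
have -> : s^-1 * y + - b / s = (y - b) / s by field; rewrite gt_eqF.
have -> : b + s * ((y - b) / s) = y by field; rewrite gt_eqF.
by rewrite /K /q EFinM muleCA.
Qed.

(** The posterior mean given by the Bayes formula: the prior [Pi] reweighted by the likelihood of
    [y]. *)
Let h (y : R) : R := weighted_mean Pi id (fun b => q (y - b)).

Let mh : measurable_fun setT h.
Proof.
have meas (f : R -> R) : measurable_fun setT f -> (forall b, 0 <= f b) ->
    measurable_fun setT (fun y : R => \int[Pi]_b (f b * q (y - b))).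
  move=> mf f0.
  apply: (measurableT_comp (fine_measurable measurableT)).
  apply: (measurable_fun_fubini_tonelli_F (m2 := Pi)
    (fun z : R * R => (f z.2 * q (z.1 - z.2))%:E)).
    apply/measurable_EFinP; apply: measurable_funM => //.
    exact: (measurableT_comp mf measurable_snd).
  by move=> z; rewrite lee_fin mulr_ge0// ltW.
apply: measurable_funM.
  apply: measurable_funB; apply: meas.
  - exact: measurable_maxr.
  - by move=> b; rewrite le_max lexx orbT.
  - by apply: measurable_maxr => //; exact: measurable_funN.
  - by move=> b; rewrite le_max lexx orbT.
apply: measurable_funV.
have := meas (cst 1) (measurable_cst _) (fun=> ler01).
by under eq_fun do under eq_Rintegral do rewrite mul1r.
Qed.

Let mqy (y : R) : measurable_fun setT (fun b : R => q (y - b)).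
Proof. by apply: (measurableT_comp mq); exact: measurable_funB. Qed.

Let sqerr (g : R -> R) := (\int[P]_w ((g (Y w) - B w) ^+ 2)%:E)%E.

Let sqerrE (g : R -> R) : measurable_fun setT g ->
  sqerr g = (\int[leb]_y \int[Pi]_b ((g y - b) ^+ 2 * q (y - b))%:E)%E.
Proof.
move=> mg; rewrite /sqerr.
rewrite (@integral_channel (fun b y => ((g y - b) ^+ 2)%:E)).
- by apply: eq_integral => y _; apply: eq_integral => b _; rewrite EFinM.
- apply/measurable_EFinP; apply: measurable_funX; apply: measurable_funB => //.
  exact: (measurableT_comp mg measurable_snd).
- by move=> b y; rewrite lee_fin sqr_ge0.
Qed.

Let sqerr_min (g : R -> R) : measurable_fun setT g -> (sqerr h <= sqerr g)%E.
Proof.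
move=> mg; rewrite !sqerrE//.
have minner (f : R -> R) : measurable_fun setT f -> measurable_fun setT (fun y : R =>
    \int[Pi]_b ((f y - b) ^+ 2 * q (y - b))%:E)%E.
  move=> mf; apply: (measurable_fun_fubini_tonelli_F (m2 := Pi)
    (fun z : R * R => ((f z.1 - z.2) ^+ 2 * q (z.1 - z.2))%:E)).
    apply/measurable_EFinP; apply: measurable_funM => //.
    apply: measurable_funX; apply: measurable_funB; last exact: measurable_snd.
    exact: (measurableT_comp mf measurable_fst).
  by move=> z; rewrite lee_fin mulr_ge0 ?sqr_ge0// ltW.
apply: ge0_le_integral => //.
- move=> y _; apply: integral_ge0 => b _.
  by rewrite lee_fin mulr_ge0 ?sqr_ge0// ltW.
- exact: minner.
- exact: minner.
- move=> y _.
  exact: (@weighted_mean_min _ (measurableTypeR R) R Pi id _ _ (@measurable_id _ _ setT) (mqy y) (fun b => q_gt0 (y - b))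
    (fun b => q_le (y - b)) Pi2).
Qed.

Let PX2 : (\int[P]_w (B w ^+ 2)%:E = \int[Pi]_b (b ^+ 2)%:E)%E.
Proof.
have mF : measurable_fun setT (fun w : R * R => (w.1 ^+ 2)%:E).
  apply/measurable_EFinP; apply: measurable_funX; exact: measurable_fst.
have F0 (w : R * R) : (0 <= (w.1 ^+ 2)%:E)%E by rewrite lee_fin sqr_ge0.
rewrite (fubini_tonelli1 (m1 := Pi) (m2 := N01) _ mF F0).
apply: eq_integral => b _.
transitivity (\int[N01]_y cst (b ^+ 2)%:E y)%E; first by [].
by rewrite integral_cst//= probability_setT mule1.
Qed.

Let sqerr_fin : (sqerr h < +oo)%E.
Proof.
(* The zero estimator has the second moment of [Pi] as its error. *)
apply: le_lt_trans (sqerr_min (@measurable_cst _ _ _ _ _ (0 : R))) _.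
rewrite /sqerr; under eq_integral do rewrite sub0r sqrrN.
by rewrite PX2.
Qed.

Let PT : P setT = 1%E.
Proof.
rewrite /P -setXTT product_measure1E//.
by rewrite -(probability_setT Pi) -[RHS]mule1 -(probability_setT N01).
Qed.

Let integrable_sqr (f : R * R -> R) : measurable_fun setT f ->
  (\int[P]_w (f w ^+ 2)%:E < +oo)%E -> P.-integrable setT (EFin \o f).
Proof.
move=> mf f2.
have i2 : P.-integrable setT (EFin \o (fun w => f w ^+ 2)).
  apply/integrableP; split; first by apply/measurable_EFinP; exact: measurable_funX.
  by under eq_integral do rewrite gee0_abs ?lee_fin ?sqr_ge0//.
have i1 : P.-integrable setT (EFin \o (fun _ => 1 : R)).
  apply/integrableP; split; first exact/measurable_EFinP.
  rewrite (_ : (fun _ => _) = cst 1%E); last by apply/funext => w; rewrite /= normr1.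
  by rewrite integral_cst// mul1e [X in (X < _)%E]PT ltry.
apply: le_integrable (integrableD measurableT i1 i2) => //.
  exact/measurable_EFinP.
by move=> w _ /=; rewrite lee_fin [leRHS]ger0_norm ?addr_ge0 ?sqr_ge0// normr_le_1Dsqr.
Qed.

Let iB : P.-integrable setT (EFin \o B).
Proof. by apply: integrable_sqr => //; rewrite PX2. Qed.

Let mhY : measurable_fun setT (h \o Y). Proof. exact: measurableT_comp. Qed.

Let iHB : P.-integrable setT (EFin \o (fun w => h (Y w) - B w)).
Proof. by apply: integrable_sqr; first exact: measurable_funB. Qed.

Let iH : P.-integrable setT (EFin \o (h \o Y)).
Proof.
apply: eq_integrable (integrableD measurableT iHB iB) => //.
by move=> w _ /=; rewrite -EFinD subrK.
Qed.

(** The defining equation of the conditional expectation on the event that [Y] lies in [C]. The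
    signs are kept apart because [integral_channel] takes nonnegative integrands. *)
Let h_centered (C : set R) : measurable C ->
  (\int[P]_w (\1_C (Y w) * Num.max (h (Y w) - B w) 0)%:E =
   \int[P]_w (\1_C (Y w) * Num.max (B w - h (Y w)) 0)%:E)%E.
Proof.
move=> mC.
have mi : measurable_fun setT (fun z : R * R => \1_C z.2 : R).
  have mi1 : measurable_fun setT (\1_C : R -> R) by exact: measurable_indic.
  exact: (measurableT_comp mi1 measurable_snd).
have mh2 : measurable_fun setT (fun z : R * R => h z.2).
  exact: (measurableT_comp mh measurable_snd).
rewrite (@integral_channel (fun b y => (\1_C y * Num.max (h y - b) 0)%:E)); last 2 first.
- apply/measurable_EFinP; apply: measurable_funM => //.
  by apply: measurable_maxr => //; exact: measurable_funB.
- by move=> b y; rewrite lee_fin mulr_ge0// le_max lexx orbT.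
rewrite (@integral_channel (fun b y => (\1_C y * Num.max (b - h y) 0)%:E)); last 2 first.
- apply/measurable_EFinP; apply: measurable_funM => //.
  by apply: measurable_maxr => //; exact: measurable_funB.
- by move=> b y; rewrite lee_fin mulr_ge0// le_max lexx orbT.
apply: eq_integral => y _.
have pull (f : R -> R) : measurable_fun setT f ->
    (\int[Pi]_b ((\1_C y * Num.max (f b) 0)%:E * (q (y - b))%:E) =
     (\1_C y)%:E * \int[Pi]_b (Num.max (f b) 0 * q (y - b))%:E)%E.
  move=> mf; rewrite -ge0_integralZl//.
  - by apply: eq_integral => b _; rewrite !EFinM !muleA.
  - apply/measurable_EFinP; apply: measurable_funM; last exact: mqy.
    exact: measurable_maxr.
  - move=> b _; rewrite lee_fin; apply: mulr_ge0; last exact: ltW.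
    by rewrite le_max lexx orbT.
have mB1 : measurable_fun setT (fun b : R => h y - b).
  by apply: measurable_funB; [exact: measurable_cst|exact: measurable_id].
have mB2 : measurable_fun setT (fun b : R => b - h y).
  by apply: measurable_funB; [exact: measurable_id|exact: measurable_cst].
apply: etrans (pull _ mB1) (etrans _ (esym (pull _ mB2))).
congr (_ * _)%E.
exact: (@weighted_mean_centered _ (measurableTypeR R) R Pi id _ _ (@measurable_id _ _ setT) (mqy y) (fun b => q_gt0 (y - b))
    (fun b => q_le (y - b)) Pi2).
Qed.

Let T := (measurableTypeR R * measurableTypeR R)%type.

Let sigmaY_measurable (A : set T) :
  g_sigma_algebra_preimage Y A -> measurable A.
Proof. by move=> [C mC <-]; exact: mY. Qed.

Let integral_setY (A : set T) : measurable A ->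
  (\int[P]_(w in A) (h (Y w) - B w)%:E =
   \int[P]_(w in A) (h (Y w))%:E - \int[P]_(w in A) (B w)%:E)%E.
Proof.
move=> mA.
exact: (integralB_EFin mA (integrableS (@measurableT _ T) mA (@subsetT _ A) iH)
  (integrableS (@measurableT _ T) mA (@subsetT _ A) iB)).
Qed.

Let condexp_h : is_cond_expectation P B Y (h \o Y).
Proof.
split; [|exact: iH|].
- move=> C mC; exists (h @^-1` C); last by rewrite setTI.
  by rewrite -[X in measurable X]setTI; exact: mh.
- move=> A sA; have mA := sigmaY_measurable sA.
  have fH : (\int[P]_(w in A) (h (Y w))%:E)%E \is a fin_num.
    exact: (integrable_fin_num mA (integrableS (@measurableT _ T) mA (@subsetT _ A) iH)).
  have fB : (\int[P]_(w in A) (B w)%:E)%E \is a fin_num.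
    exact: (integrable_fin_num mA (integrableS (@measurableT _ T) mA (@subsetT _ A) iB)).
  have fin_eq (x y : \bar R) : x \is a fin_num -> y \is a fin_num ->
      (x - y = 0)%E -> x = y.
    case: x => // x; case: y => // y _ _; rewrite -EFinB => -[/eqP].
    by rewrite subr_eq0 => /eqP ->.
  apply: fin_eq => //; rewrite -integral_setY//.
  move: sA => [C mC]; rewrite setTI => AE.
  rewrite integralE.
  have restr (f : R * R -> R) : (forall w, 0 <= f w) ->
      (\int[P]_(w in A) (f w)%:E = \int[P]_w (\1_C (Y w) * f w)%:E)%E.
    move=> f0; rewrite integral_mkcond; apply: eq_integral => w _.
    rewrite patchE -AE /= indicE.
    have -> : (w \in Y @^-1` C) = (Y w \in C) by [].
    by case: ifP => _; rewrite ?mul1r ?mul0r.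
  have -> : (\int[P]_(w in A) (fun w => (h (Y w) - B w)%:E)^\+ w =
             \int[P]_(w in A) (Num.max (h (Y w) - B w) 0)%:E)%E.
    by apply: eq_integral => w _; rewrite funeposE -EFin_max.
  have En : (\int[P]_(w in A) (fun w => (h (Y w) - B w)%:E)^\- w =
             \int[P]_(w in A) (Num.max (B w - h (Y w)) 0)%:E)%E.
    by apply: eq_integral => w _; rewrite funenegE -EFinN -EFin_max opprB.
  have En_fin : (\int[P]_(w in A) (Num.max (B w - h (Y w)) 0)%:E)%E \is a fin_num.
    rewrite -En; apply: (integrable_fin_num mA); apply: (integrable_funeneg mA).
    exact: (integrableS (@measurableT _ T) mA (@subsetT _ A) iHB).
  have pos0 (a : R) : 0 <= Num.max a 0 by rewrite le_max lexx orbT.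
  move: En_fin; rewrite En !restr// h_centered// => En_fin.
  by rewrite subee.
Qed.

(** The event [f < g] belongs to the sigma-algebra of [Y], so [f] and [g] have the same integral
    over it, although [g - f] is positive there. *)
Let condexp_ae (f g : R * R -> R) :
  is_cond_expectation P B Y f -> is_cond_expectation P B Y g ->
  P [set w | f w < g w] = 0%E.
Proof.
move=> [sf jf ef] [sg jg eg].
pose A := [set w | f w < g w].
have sA : g_sigma_algebra_preimage Y A.
  have mf : measurable_fun setT (f : g_sigma_algebra_preimageType Y -> R).
    by move=> _ C mC; rewrite setTI; exact: sf.
  have mg : measurable_fun setT (g : g_sigma_algebra_preimageType Y -> R).
    by move=> _ C mC; rewrite setTI; exact: sg.
  have := measurable_fun_ltr mf mg measurableT (Y := [set true]).
  by rewrite setTI; apply.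
have mA := sigmaY_measurable sA.
have jfA := integrableS (@measurableT _ T) mA (@subsetT _ A) jf.
have jgA := integrableS (@measurableT _ T) mA (@subsetT _ A) jg.
have mfg : measurable_fun setT (fun w => (g w - f w)%:E).
  have /measurable_EFinP mf := measurable_int _ jf.
  have /measurable_EFinP mg := measurable_int _ jg.
  by apply/measurable_EFinP; exact: measurable_funB.
have : (\int[P]_(w in A) `|(g w - f w)%:E| = 0)%E.
  transitivity (\int[P]_(w in A) (g w - f w)%:E)%E.
    by apply: eq_integral => w /set_mem Aw; rewrite gee0_abs// lee_fin subr_ge0 ltW.
  rewrite (integralB_EFin mA jgA jfA) eg// ef// subee//.
  exact: (integrable_fin_num mA (integrableS (@measurableT _ T) mA (@subsetT _ A) iB)).
move=> /(ae_eq_integral_abs P mA (measurable_funTS mfg))[N [mN N0 subN]].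
apply/eqP; rewrite eq_le measure_ge0 andbT -N0 le_measure ?inE// => w Aw.
apply: subN => /= /(_ Aw)/eqP; rewrite eqe subr_eq0 => /eqP gf.
by move: Aw; rewrite /A/= gf ltxx.
Qed.

(** Since [h \o Y] is a conditional expectation, the choice made by [xget] is one too, and any two
    versions agree almost everywhere. *)
Lemma mmseE : (mmse Pi tau)%:E = sqerr h.
Proof.
have hc := condexp_h.
have fc : is_cond_expectation P B Y (cond_expectation P B Y).
  exact: (@xgetI _ (cst 0) [set f | is_cond_expectation P B Y f] (h \o Y)).
have sq0 : (0 <= sqerr h)%E by apply: integral_ge0 => w _; rewrite lee_fin sqr_ge0.
rewrite -[RHS]fineK; last by rewrite ge0_fin_numE.
congr ((fine _)%:E); rewrite /sqerr.
have ltA (f g : R * R -> R) : measurable_fun setT f -> measurable_fun setT g ->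
    measurable ([set w | f w < g w] : set T).
  move=> mf mg.
  have := measurable_fun_ltr mf mg measurableT (Y := [set true]).
  by rewrite setTI; apply.
have mc : measurable_fun setT (cond_expectation P B Y).
  by case: fc => _ /measurable_int/measurable_EFinP.
have meas (f : R * R -> R) : measurable_fun setT f ->
    measurable_fun setT (fun w => ((f w - B w) ^+ 2)%:E).
  by move=> mf; apply/measurable_EFinP; apply: measurable_funX; exact: measurable_funB.
apply: ge0_ae_eq_integral => //; [exact: meas|exact: (meas (h \o Y))|..].
- by move=> w _; rewrite lee_fin sqr_ge0.
- by move=> w _; rewrite lee_fin sqr_ge0.
- exists ([set w | cond_expectation P B Y w < h (Y w)] `|`
          [set w | h (Y w) < cond_expectation P B Y w]); split.
  + by apply: measurableU; exact: ltA.
  + rewrite measureU0; [|exact: ltA|exact: ltA|exact: (condexp_ae hc fc)].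
    exact: (condexp_ae fc hc).
  + move=> w /= => neq; apply: contrapT => /not_orP[/negP + /negP].
    rewrite -!leNgt => le1 le2; apply: neq => _.
    by congr (((_ - _) ^+ 2)%:E); apply/eqP; rewrite eq_le le1 le2.
Qed.

Lemma mmse_le (g : R -> R) : measurable_fun setT g ->
  ((mmse Pi tau)%:E <=
   \int[(Pi \x N01)%E]_w ((g (w.1 + s * w.2)%R - w.1) ^+ 2)%:E)%E.
Proof. by move=> mg; rewrite mmseE; exact: sqerr_min. Qed.

Lemma mmse_attained : exists2 g : R -> R, measurable_fun setT g &
  ((mmse Pi tau)%:E =
   \int[(Pi \x N01)%E]_w ((g (w.1 + s * w.2)%R - w.1) ^+ 2)%:E)%E.
Proof. by exists h => //; rewrite mmseE. Qed.

End mmse.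

(** * Comparison of two noise levels *)

Section mmse_order.
Context (R : realType) (Pi : probability (measurableTypeR R) R).
Hypothesis Pi2 : finite_second_moment Pi.
Local Notation N01 := (normal_prob (0 : R) 1).

Let V : R := \int[Pi]_b (b ^+ 2).

Let VE : (\int[Pi]_b (b ^+ 2)%:E = V%:E)%E.
Proof.
rewrite /V /Rintegral fineK// ge0_fin_numE//.
by apply: integral_ge0 => b _; rewrite lee_fin sqr_ge0.
Qed.

Let V0 : 0 <= V. Proof. by apply: Rintegral_ge0 => b _; exact: sqr_ge0. Qed.

Lemma mmse_ge0 (tau : R) : 0 <= mmse Pi tau.
Proof. by apply: Rintegral_ge0 => w _; exact: sqr_ge0. Qed.

(** The right-hand side is the error of the linear estimator [a * y]: a bias [(1 - a) * b] and a
    noise [a * sqrt tau * z]. *)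
Lemma mmse_le_affine (tau a : R) : 0 < tau ->
  mmse Pi tau <= (1 - a) ^+ 2 * V + a ^+ 2 * tau.
Proof.
move=> tau0.
have s2 : Num.sqrt tau ^+ 2 = tau by rewrite sqr_sqrtr// ltW.
have ma : measurable_fun setT (fun y : R => a * y) by exact: measurable_funM.
rewrite -lee_fin; apply: (le_trans (mmse_le Pi2 tau0 ma)).
have mF : measurable_fun setT (fun w : R * R =>
    ((a * (w.1 + Num.sqrt tau * w.2) - w.1) ^+ 2)%:E).
  apply/measurable_EFinP; apply: measurable_funX.
  apply: measurable_funB; last exact: measurable_fst.
  apply: measurable_funM => //; apply: measurable_funD; first exact: measurable_fst.
  by apply: measurable_funM => //; exact: measurable_snd.
have F0 (w : R * R) : (0 <= ((a * (w.1 + Num.sqrt tau * w.2) - w.1) ^+ 2)%:E)%E.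
  by rewrite lee_fin sqr_ge0.
rewrite (fubini_tonelli1 (m1 := Pi) (m2 := N01) _ mF F0).
rewrite le_eqVlt; apply/orP; left; apply/eqP.
transitivity (\int[Pi]_b (((1 - a) ^+ 2)%:E * (b ^+ 2)%:E + (a ^+ 2 * tau)%:E))%E.
  apply: eq_integral => b _.
  transitivity (\int[N01]_z (((a - 1) * b + (a * Num.sqrt tau) * z) ^+ 2)%:E)%E.
    by apply: eq_integral => z _; congr EFin; rewrite /=; ring.
  rewrite integral_normal01_affine_sqr -EFinM -EFinD; congr EFin.
  by rewrite exprMn [in X in _ + X]exprMn s2; ring.
have m2 : measurable_fun setT (fun b : measurableTypeR R => (b ^+ 2)%:E).
  by apply/measurable_EFinP; exact: measurable_funX.
have p2 (b : measurableTypeR R) : (0 <= (b ^+ 2)%:E)%E by rewrite lee_fin sqr_ge0.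
have c1 : (0 <= ((1 - a) ^+ 2)%:E)%E by rewrite lee_fin sqr_ge0.
have c2 : (0 <= (a ^+ 2 * tau)%:E)%E by rewrite lee_fin mulr_ge0 ?sqr_ge0// ltW.
rewrite ge0_integralD//.
- rewrite ge0_integralZl// VE integral_cst//.
  rewrite [X in (_ + _ * X)%E](_ : _ = 1%E) ?mule1; last exact: probability_setT.
  by rewrite -EFinM -EFinD.
- by move=> b _; exact: mule_ge0.
- exact: emeasurable_funM.
Qed.

(* Adding noise [c1 w] of variance
   [t2 - t1] to [y = b + s1 z] gives an observation at noise [t2], and [y - (t1 / c1) w] is an
   observation whose noise is independent of the former one, with variance [t1 t2 / (t2 - t1)].
   For each [w], [(1 - a) g (y + c1 w) + a (y - (t1 / c1) w)] is an estimator at noise [t1]. *)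
Lemma mmse_snr_gain (t1 t2 a : R) : 0 < t1 -> t1 < t2 ->
  mmse Pi t1 <= (1 - a) ^+ 2 * mmse Pi t2 + a ^+ 2 * (t1 * t2 / (t2 - t1)).
Proof.
move=> t10 t12; have t20 := lt_trans t10 t12.
have t210 : 0 < t2 - t1 by rewrite subr_gt0.
have [g mg gE] := mmse_attained Pi2 t20.
pose s1 := Num.sqrt t1; pose s2 := Num.sqrt t2; pose c1 := Num.sqrt (t2 - t1).
have s1E : s1 ^+ 2 = t1 by rewrite sqr_sqrtr// ltW.
have s2E : s2 ^+ 2 = t2 by rewrite sqr_sqrtr// ltW.
have c1E : c1 ^+ 2 = t2 - t1 by rewrite sqr_sqrtr// ltW.
have s10 : 0 < s1 by rewrite sqrtr_gt0.
have s20 : 0 < s2 by rewrite sqrtr_gt0.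
have c10 : 0 < c1 by rewrite sqrtr_gt0.
(* The standard deviation of the second noise: [s1 * z - t1 / c1 * w] is [be] times the unit normal
   [c1 / s2 * z - s1 / s2 * w]. *)
pose be := s1 * s2 / c1.
pose H (w b z : R) : R :=
  ((1 - a) * (g (b + s1 * z + c1 * w) - b) + a * (s1 * z - t1 / c1 * w)) ^+ 2.
have H0 w b z : 0 <= H w b z by exact: sqr_ge0.
pose F (b u v : R) : R := ((1 - a) * (g (b + s2 * u) - b) + a * be * v) ^+ 2.
have mH : measurable_fun setT (fun x : R * (R * R) => H x.1 x.2.1 x.2.2).
  have m1 : measurable_fun setT (fun x : R * (R * R) => x.1) by exact: measurable_fst.
  have m2 : measurable_fun setT (fun x : R * (R * R) => x.2) by exact: measurable_snd.
  have m21 : measurable_fun setT (fun x : R * (R * R) => x.2.1).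
    exact: (measurableT_comp measurable_fst m2).
  have m22 : measurable_fun setT (fun x : R * (R * R) => x.2.2).
    exact: (measurableT_comp measurable_snd m2).
  apply: measurable_funX; apply: measurable_funD; apply: measurable_funM => //.
    apply: measurable_funB => //; apply: (measurableT_comp mg).
    apply: measurable_funD; last exact: measurable_funM.
    by apply: measurable_funD => //; exact: measurable_funM.
  by apply: measurable_funB; exact: measurable_funM.
have step1 w : ((mmse Pi t1)%:E <= \int[(Pi \x N01)%E]_x (H w x.1 x.2)%:E)%E.
  have mgw : measurable_fun setT (fun y : R =>
      (1 - a) * g (y + c1 * w) + a * (y - t1 / c1 * w)).
    apply: measurable_funD; apply: measurable_funM => //.
      apply: (measurableT_comp mg); exact: measurable_funD.
    exact: measurable_funB.
  apply: (le_trans (mmse_le Pi2 t10 mgw)).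
  rewrite le_eqVlt; apply/orP; left; apply/eqP.
  by apply: eq_integral => x _; congr EFin; rewrite -/s1 /H; ring.
have mHE : measurable_fun setT (fun x : R * (R * R) => (H x.1 x.2.1 x.2.2)%:E).
  exact/measurable_EFinP.
have HE0 (x : R * (R * R)) : (0 <= (H x.1 x.2.1 x.2.2)%:E)%E by rewrite lee_fin.
pose N : probability (measurableTypeR R) R := N01.
pose PN : probability (measurableTypeR R * measurableTypeR R)%type R := (Pi \x N)%E.
(* The bound holds for each fixed [w], hence on average over an auxiliary normal [w]. *)
have step2 : ((mmse Pi t1)%:E <= \int[N01]_w \int[(Pi \x N01)%E]_x (H w x.1 x.2)%:E)%E.
  apply: (@le_trans _ _ (\int[N01]_w cst (mmse Pi t1)%:E w)%E).
    rewrite integral_cst// [X in (_ <= _ * X)%E](_ : _ = 1%E) ?mule1//.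
    exact: probability_setT.
  apply: ge0_le_integral => //.
  - by move=> w _; rewrite lee_fin mmse_ge0.
  - exact: (measurable_fun_fubini_tonelli_F (m2 := PN) _ mHE HE0).
have step3 : (\int[N01]_w \int[(Pi \x N01)%E]_x (H w x.1 x.2)%:E =
  \int[Pi]_b \int[N01]_z \int[N01]_w (H w b z)%:E)%E.
  rewrite (fubini_tonelli (m1 := N01) (m2 := PN) _ mHE HE0).
  have mG := measurable_fun_fubini_tonelli_G (m1 := N01) _ mHE HE0.
  rewrite (fubini_tonelli1 (m1 := Pi) (m2 := N01) _ mG)//.
  by move=> x; apply: integral_ge0 => w _; rewrite lee_fin.
have step4 b : (\int[N01]_z \int[N01]_w (H w b z)%:E =
   ((1 - a) ^+ 2)%:E * \int[N01]_u ((g (b + s2 * u)%R - b) ^+ 2)%:E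
   + (a ^+ 2 * (t1 * t2 / (t2 - t1)))%:E)%E.
  have cs : (s1 / s2) ^+ 2 + (c1 / s2) ^+ 2 = 1.
    rewrite !expr_div_n s1E s2E c1E -mulrDl addrC subrK divff//.
    by rewrite gt_eqF.
  have mF : measurable_fun setT (fun z : R * R => (F b z.1 z.2)%:E).
    have m1 : measurable_fun setT (fun x : R * R => x.1) by exact: measurable_fst.
    have m2 : measurable_fun setT (fun x : R * R => x.2) by exact: measurable_snd.
    apply/measurable_EFinP; apply: measurable_funX; apply: measurable_funD.
      apply: measurable_funM => //; apply: measurable_funB => //.
      apply: (measurableT_comp mg); apply: measurable_funD => //.
      exact: measurable_funM.
    exact: measurable_funM.
  have F0 u v : (0 <= (F b u v)%:E)%E by rewrite lee_fin sqr_ge0.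
  (* The reflection turns [(z, w)] into the total noise [u], seen by [g], and a [v] that enters [F]
     linearly only, so the integral over [v] is explicit. *)
  have := normal01_rotation (divr_gt0 c10 s20) cs mF F0.
  have -> : (\int[N01]_z \int[N01]_w
      (F b (s1 / s2 * z + c1 / s2 * w)%R (c1 / s2 * z - s1 / s2 * w)%R)%:E =
      \int[N01]_z \int[N01]_w (H w b z)%:E)%E.
    apply: eq_integral => z _; apply: eq_integral => w _; congr EFin.
    rewrite /F /H /be -s1E.
    have -> : b + s2 * (s1 / s2 * z + c1 / s2 * w) = b + s1 * z + c1 * w.
      by field; rewrite gt_eqF.
    congr (_ ^+ 2); congr (_ + _); field.
    by rewrite !gt_eqF.
  move=> ->.
  have mgb : measurable_fun setT (fun u : R => ((g (b + s2 * u) - b) ^+ 2)%:E).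
    apply/measurable_EFinP; apply: measurable_funX; apply: measurable_funB => //.
    by apply: (measurableT_comp mg); exact: measurable_funD.
  have gb0 u : (0 <= ((g (b + s2 * u) - b) ^+ 2)%:E)%E by rewrite lee_fin sqr_ge0.
  have beE : be ^+ 2 = t1 * t2 / (t2 - t1).
    by rewrite /be expr_div_n exprMn s1E s2E c1E.
  transitivity (\int[N01]_u (((1 - a) ^+ 2)%:E * ((g (b + s2 * u)%R - b) ^+ 2)%:E
     + (a ^+ 2 * be ^+ 2)%:E))%E.
    apply: eq_integral => u _; rewrite /F integral_normal01_affine_sqr.
    by rewrite -EFinM -EFinD; congr EFin; rewrite !exprMn.
  rewrite -beE ge0_integralD//.
  - rewrite ge0_integralZl//; last by rewrite lee_fin sqr_ge0.
    rewrite integral_cst//.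
    rewrite [X in (_ + _ * X)%E](_ : _ = 1%E) ?mule1//; exact: probability_setT.
  - by move=> u _; rewrite mule_ge0// lee_fin sqr_ge0.
  - exact: emeasurable_funM.
  - by move=> u _; rewrite lee_fin mulr_ge0 ?sqr_ge0.
rewrite -lee_fin; apply: (le_trans step2); rewrite step3.
under eq_integral do rewrite step4.
rewrite le_eqVlt; apply/orP; left; apply/eqP.
have mG : measurable_fun setT (fun x : R * R => ((g (x.1 + s2 * x.2) - x.1) ^+ 2)%:E).
  have m1 : measurable_fun setT (fun x : R * R => x.1) by exact: measurable_fst.
  have m2 : measurable_fun setT (fun x : R * R => x.2) by exact: measurable_snd.
  apply/measurable_EFinP; apply: measurable_funX; apply: measurable_funB => //.
  apply: (measurableT_comp mg); apply: measurable_funD => //.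
  exact: measurable_funM.
have G0 (x : R * R) : (0 <= ((g (x.1 + s2 * x.2)%R - x.1) ^+ 2)%:E)%E.
  by rewrite lee_fin sqr_ge0.
have be0 : 0 <= t1 * t2 / (t2 - t1).
  by rewrite ltW// divr_gt0// mulr_gt0.
have mGF := measurable_fun_fubini_tonelli_F (m2 := N) _ mG G0.
have GF0 (b : measurableTypeR R) :
    (0 <= \int[N01]_u ((g (b + s2 * u)%R - b) ^+ 2)%:E)%E.
  by apply: integral_ge0 => u _; rewrite lee_fin sqr_ge0.
rewrite ge0_integralD//.
- rewrite ge0_integralZl//; last by rewrite lee_fin sqr_ge0.
  rewrite [RHS](_ : _ = ((1 - a) ^+ 2)%:E * (mmse Pi t2)%:E +
    (a ^+ 2 * (t1 * t2 / (t2 - t1)))%:E)%E// gE.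
  rewrite (fubini_tonelli1 (m1 := Pi) (m2 := N) _ mG G0).
  congr (_ + _)%E; rewrite integral_cst//.
  rewrite [X in (_ * X)%E](_ : _ = 1%E) ?mule1//; exact: probability_setT.
- by move=> b _; rewrite mule_ge0// lee_fin sqr_ge0.
- exact: emeasurable_funM.
- by move=> b _; rewrite lee_fin mulr_ge0 ?sqr_ge0.
Qed.

(** The coefficient [V / (V + tau)] minimizes the linear bound, whose value becomes
    [V * tau / (V + tau)]. *)
Lemma mmse_le_lmmse (tau : R) : 0 < tau -> mmse Pi tau * (V + tau) <= V * tau.
Proof.
move=> tau0; have Vt : 0 < V + tau by rewrite ltr_wpDl.
have := mmse_le_affine (V / (V + tau)) tau0.
have -> : (1 - V / (V + tau)) ^+ 2 * V + (V / (V + tau)) ^+ 2 * tau = V * tau / (V + tau).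
  by field; rewrite gt_eqF.
by rewrite ler_pdivlMr.
Qed.

Lemma mmse_lt (tau : R) : 0 < tau -> mmse Pi tau < tau.
Proof.
move=> tau0; have Vt : 0 < V + tau by rewrite ltr_wpDl.
rewrite -(ltr_pM2r Vt); apply: le_lt_trans (mmse_le_lmmse tau0) _.
by have := mulr_gt0 tau0 tau0; nra.
Qed.

Let den_gt0 (tau : R) : 0 < tau -> 0 < 1 - mmse Pi tau / tau.
Proof. by move=> t0; rewrite subr_gt0 ltr_pdivrMr// mul1r mmse_lt. Qed.

(* That is [1 / mmse t2 + 1 / t1 - 1 / t2 <= 1 / mmse t1], free of division by [mmse]. *)
Lemma mmse_snr (t1 t2 : R) : 0 < t1 -> t1 <= t2 ->
  mmse Pi t1 * (1 + mmse Pi t2 * (t1^-1 - t2^-1)) <= mmse Pi t2.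
Proof.
move=> t10; rewrite le_eqVlt => /predU1P[->|t12].
  by rewrite subrr mulr0 addr0 mulr1.
have t20 := lt_trans t10 t12.
have t210 : 0 < t2 - t1 by rewrite subr_gt0.
set d := t1^-1 - t2^-1.
have dE : d = (t2 - t1) / (t1 * t2) by rewrite /d; field; rewrite !gt_eqF.
have d0 : 0 < d by rewrite dE divr_gt0// mulr_gt0.
have m20 := mmse_ge0 t2; set m2 := mmse Pi t2 in m20 *.
have D0 : 0 < 1 + m2 * d by rewrite ltr_wpDr// mulr_ge0// ltW.
(* This [a] minimizes [(1 - a) ^+ 2 * m2 + a ^+ 2 / d]: the two independent errors are weighted by
   inverse variance. *)
have := mmse_snr_gain (m2 * d / (1 + m2 * d)) t10 t12; rewrite -/m2.
have -> : t1 * t2 / (t2 - t1) = d^-1 by rewrite dE invf_div.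
have -> : (1 - m2 * d / (1 + m2 * d)) ^+ 2 * m2 + (m2 * d / (1 + m2 * d)) ^+ 2 / d
          = m2 / (1 + m2 * d).
  by field; rewrite !gt_eqF.
by rewrite ler_pdivlMr.
Qed.

Lemma mmse_nondecreasing (t1 t2 : R) : 0 < t1 -> t1 <= t2 ->
  mmse Pi t1 <= mmse Pi t2.
Proof.
move=> t10 t12; have t20 := lt_le_trans t10 t12.
apply: le_trans (mmse_snr t10 t12); rewrite ler_peMr ?mmse_ge0//.
by rewrite lerDl mulr_ge0 ?mmse_ge0// subr_ge0 lef_pV2.
Qed.

Lemma extrinsic_mmse_ge0 (tau : R) : 0 < tau -> 0 <= extrinsic_mmse Pi tau.
Proof. by move=> t0; rewrite divr_ge0 ?mmse_ge0// ltW// den_gt0. Qed.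

(** If [mmse] attained its linear bound [V * tau / (V + tau)], the quotient would be exactly [V].
    The bound is uniform in [tau] and so caps the fixed-point map. *)
Lemma extrinsic_mmse_le (tau : R) : 0 < tau -> extrinsic_mmse Pi tau <= V.
Proof.
move=> t0; rewrite ler_pdivrMr ?den_gt0// -(ler_pM2r t0).
have -> : V * (1 - mmse Pi tau / tau) * tau = V * (tau - mmse Pi tau).
  by field; rewrite gt_eqF.
by have := mmse_le_lmmse t0; rewrite mulrDr mulrBr lerBrDr (mulrC V (mmse _ _)) addrC.
Qed.

Lemma extrinsic_mmse_eq0 (tau : R) : 0 < tau ->
  extrinsic_mmse Pi tau = 0 -> mmse Pi tau = 0.
Proof.
move=> t0 /eqP; rewrite mulf_eq0 invr_eq0 (gt_eqF (den_gt0 t0)) orbF.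
by move/eqP.
Qed.

Lemma extrinsic_mmse_nondecreasing (t1 t2 : R) : 0 < t1 -> t1 <= t2 ->
  extrinsic_mmse Pi t1 <= extrinsic_mmse Pi t2.
Proof.
move=> t10 t12; have t20 := lt_le_trans t10 t12.
rewrite ler_pdivrMr ?den_gt0// mulrAC ler_pdivlMr ?den_gt0//.
have := mmse_snr t10 t12; move: (mmse Pi t1) (mmse Pi t2) => m1 m2.
by rewrite -subr_ge0 => le0; rewrite -subr_ge0; move: le0; congr (0 <= _); ring.
Qed.

End mmse_order.

(** * The map L and its largest fixed point *)

(* [f] need not be continuous: the fixed point is [sup {u | u <= f u}], as in Tarski's theorem. *)
Lemma max_fixpoint (R : realType) (f : R -> R) (a b : R) :
  0 < a -> (forall t, 0 < t -> a <= f t <= b) ->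
  (forall t u, 0 < t -> t <= u -> f t <= f u) ->
  exists t, [/\ 0 < t, f t = t & forall u, 0 < u -> u <= f u -> u <= t].
Proof.
move=> a0 fab fnd.
pose S := [set u : R | 0 < u /\ u <= f u].
have Sa : S a by split => //; have /andP[] := fab _ a0.
have ubS : has_ubound S.
  by exists b => u [u0 /le_trans]; apply; have /andP[] := fab _ u0.
have hsS : has_sup S by split => //; exists a.
have leS u : 0 < u -> u <= f u -> u <= sup S.
  by move=> u0 ufu; apply: ub_le_sup => //.
have t0 : 0 < sup S by apply: (lt_le_trans a0); apply: leS; case: Sa.
have tft : sup S <= f (sup S).
  apply: ge_sup; first by exists a.
  by move=> u [u0 ufu]; apply: (le_trans ufu); apply: fnd => //; exact: leS.
exists (sup S); split => //; apply/eqP; rewrite eq_le tft andbT.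
(* Applying [f] to [sup S <= f (sup S)] shows that [f (sup S)] is itself in [S]. *)
by apply: leS; [exact: lt_le_trans tft|exact: fnd].
Qed.

(** * Monotonicity of [L] for a compactly supported law *)

Section compactly_supported.
Context (R : realType) (mu : probability (measurableTypeR R) R) (M : R).
Hypothesis supp : mu (~` `[0, M]) = 0%E.
Let D : set (measurableTypeR R) := `[0, M]%classic.

Let mD : measurable D. Proof. exact: measurable_itv. Qed.

Let mDC : measurable (~` D). Proof. exact: measurableC. Qed.

Lemma supp_integrable (f : R -> R) (K : R) : measurable_fun setT f ->
  (forall s, 0 <= s -> s <= M -> `|f s| <= K) ->
  mu.-integrable setT (EFin \o f).
Proof.
move=> mf fK.
apply/(negligible_integrable mDC measurableT _ supp); first exact/measurable_EFinP.
rewrite setDE setCK setTI.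
apply: (@le_integrable _ _ _ mu D mD _ (EFin \o cst K)).
- by apply/measurable_EFinP; exact: measurable_funTS.
- move=> s; rewrite /D/= in_itv/= => /andP[s0 sM]; rewrite lee_fin.
  exact: (le_trans (fK _ s0 sM) (ler_norm K)).
- exact: finite_measure_integrable_cst.
Qed.

Lemma supp_le (f g : R -> R) : mu.-integrable setT (EFin \o f) ->
  mu.-integrable setT (EFin \o g) ->
  (forall s, 0 <= s -> s <= M -> f s <= g s) ->
  \int[mu]_s f s <= \int[mu]_s g s.
Proof.
move=> jf jg fg.
have restr (h : R -> R) : mu.-integrable setT (EFin \o h) ->
    \int[mu]_s h s = \int[mu]_(s in D) h s.
  move=> jh; rewrite /Rintegral (negligible_integral mDC measurableT jh supp).
  by rewrite setDE setCK setTI.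
rewrite !restr//; apply: le_Rintegral => //.
- exact: (integrableS measurableT mD (@subsetT _ D) jf).
- exact: (integrableS measurableT mD (@subsetT _ D) jg).
- by move=> s; rewrite /D/= in_itv/= => /andP[s0 sM]; exact: fg.
Qed.

Lemma supp_eq (f g : R -> R) : mu.-integrable setT (EFin \o f) ->
  mu.-integrable setT (EFin \o g) ->
  (forall s, 0 <= s -> s <= M -> f s = g s) ->
  \int[mu]_s f s = \int[mu]_s g s.
Proof.
move=> jf jg fg; apply/eqP; rewrite eq_le.
by apply/andP; split; apply: supp_le => // s s0 sM; rewrite fg.
Qed.

Hypothesis mean_gt0 : 0 < \int[mu]_s s.
Variable (s2 : R).
Hypothesis s20 : 0 < s2.

Let A (w : R) := \int[mu]_s (1 / (s2 + w * s)).
Let C (w : R) := \int[mu]_s (s / (s2 + w * s)).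

Let den_gt0 w s : 0 <= w -> 0 <= s -> 0 < s2 + w * s.
Proof. by move=> w0 s0; rewrite ltr_wpDr// mulr_ge0. Qed.

Let mden w : measurable_fun setT (fun s : R => (s2 + w * s)^-1).
Proof. by apply: measurable_funV; apply: measurable_funD => //; exact: measurable_funM. Qed.

Let den_le w s : 0 <= w -> 0 <= s -> `|(s2 + w * s)^-1| <= s2^-1.
Proof.
move=> w0 s0; rewrite gtr0_norm ?invr_gt0 ?den_gt0//.
by rewrite lef_pV2 ?posrE ?den_gt0// lerDl mulr_ge0.
Qed.

Let iA w : 0 <= w -> mu.-integrable setT (EFin \o (fun s => 1 / (s2 + w * s))).
Proof.
move=> w0; apply: (supp_integrable (K := s2^-1)).
  exact: measurable_funM.
by move=> s s0 sM; rewrite mul1r den_le.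
Qed.

Let iC w : 0 <= w -> mu.-integrable setT (EFin \o (fun s => s / (s2 + w * s))).
Proof.
move=> w0; apply: (supp_integrable (K := M * s2^-1)).
  exact: measurable_funM.
by move=> s s0 sM; rewrite normrM ler_pM// ?den_le// ger0_norm.
Qed.

Let iid : mu.-integrable setT (EFin \o (fun s : R => s)).
Proof. by apply: (supp_integrable (K := M)) => // s s0 sM; rewrite ger0_norm. Qed.

Let i1 (k : R) : mu.-integrable setT (EFin \o (fun _ : R => k)).
Proof. exact: finite_measure_integrable_cst. Qed.

Let Rcst (k : R) : \int[mu]_s k = k.
Proof. exact: Rintegral_probability_cst. Qed.

Let M0 : 0 <= M.
Proof.
rewrite leNgt; apply/negP => Mlt0; move: supp.
rewrite set_itv_ge -?leNgt ?bnd_simp// setC0 probability_setT => E.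
by have := @lte01 R; rewrite E ltxx.
Qed.

Let AC w : 0 <= w -> s2 * A w + w * C w = 1.
Proof.
move=> w0; rewrite /A /C -!RintegralZl//; [|exact: iC|exact: iA].
rewrite -RintegralD//; [|exact: (integrableZl measurableT s2 (iA w0))
                        |exact: (integrableZl measurableT w (iC w0))].
transitivity (\int[mu]_s (1 : R)).
  apply: supp_eq.
  - exact: (integrableD measurableT (integrableZl measurableT s2 (iA w0))
      (integrableZl measurableT w (iC w0))).
  - exact: i1.
  - by move=> s s0 sM; field; rewrite gt_eqF ?den_gt0.
exact: Rcst.
Qed.

(** On the support the denominator is at most [s2 + w * M], so [C w] is at least a positive multiple
    of the mean. *)
Let C_gt0 w : 0 <= w -> 0 < C w.
Proof.
move=> w0; apply: (@lt_le_trans _ _ (\int[mu]_s ((s2 + w * M)^-1 * s))).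
  by rewrite RintegralZl// mulr_gt0// invr_gt0 den_gt0.
apply: supp_le; [exact: (integrableZl measurableT _ iid)|exact: iC|].
move=> s s0 sM; rewrite mulrC ler_wpM2l// lef_pV2 ?posrE ?den_gt0//.
by rewrite lerD2l ler_wpM2l.
Qed.

Let A_gt0 w : 0 <= w -> 0 < A w.
Proof.
move=> w0; apply: (@lt_le_trans _ _ (\int[mu]_s ((s2 + w * M)^-1 : R))).
  by rewrite Rcst invr_gt0 den_gt0.
apply: supp_le; [exact: i1|exact: iA|].
move=> s s0 sM; rewrite mul1r lef_pV2 ?posrE ?den_gt0//.
by rewrite lerD2l ler_wpM2l.
Qed.

(** Once the common factor [w] is cancelled, the quotient also gives the separate value at
    [w = 0]. *)
Let LmapE w : 0 <= w -> Lmap s2 mu w = s2 * A w / C w.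
Proof.
rewrite le_eqVlt /Lmap eq_sym => /predU1P[->|w0].
  rewrite eqxx; have := AC (lexx 0); rewrite mul0r addr0 => ->.
  rewrite /C mul1r; have -> : \int[mu]_s (s / (s2 + 0 * s)) = (\int[mu]_s s) / s2.
    rewrite -RintegralZr//; apply: eq_Rintegral => s _.
    by rewrite mul0r addr0.
  by rewrite invf_div.
rewrite gt_eqF//.
have -> : \int[mu]_s (s2 * w / (s2 + w * s)) = s2 * w * A w.
  rewrite /A -RintegralZl//; last exact: iA (ltW w0).
  by apply: eq_Rintegral => s _; rewrite mul1r.
have -> : \int[mu]_s (w * s / (s2 + w * s)) = w * C w.
  rewrite /C -RintegralZl//; last exact: iC (ltW w0).
  by apply: eq_Rintegral => s _; rewrite mulrA.
have Cw := C_gt0 (ltW w0); field; by rewrite !gt_eqF.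
Qed.

Lemma Lmap0_gt0 : 0 < Lmap s2 mu 0.
Proof. by rewrite /Lmap eqxx divr_gt0. Qed.

(* For [K = C w1 / A w1] the integral of [(s - K) / (s2 + w1 s)] vanishes, and
   [(s - K) / (s2 + w2 s)] lies below a multiple of this integrand, with equality at [s = K]. *)
Lemma Lmap_nondecreasing (w1 w2 : R) : 0 <= w1 -> w1 <= w2 ->
  Lmap s2 mu w1 <= Lmap s2 mu w2.
Proof.
move=> w10 w12; have w20 := le_trans w10 w12.
rewrite !LmapE// ler_pdivrMr ?C_gt0// mulrAC ler_pdivlMr ?C_gt0//.
rewrite -!mulrA ler_pM2l//.
pose K := C w1 / A w1.
have K0 : 0 <= K by rewrite divr_ge0// ltW// ?C_gt0 ?A_gt0.
(* This factor makes the two integrands tangent at [s = K], whence the square [(s - K) ^+ 2] in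
   their difference. *)
pose r := (s2 + w1 * K) / (s2 + w2 * K).
suff CK : C w2 <= K * A w2.
  by move: CK; rewrite /K -mulrA mulrCA ler_pdivlMl ?A_gt0// mulrC (mulrC (A w2)).
have i2 := integrableB measurableT (iC w20) (integrableZl measurableT K (iA w20)).
have i1' := integrableZl measurableT r
  (integrableB measurableT (iC w10) (integrableZl measurableT K (iA w10))).
rewrite -subr_le0 /A /C -RintegralZl//; last exact: iA.
rewrite -RintegralB//; [|exact: iC|exact: (integrableZl measurableT K (iA w20))].
apply: (@le_trans _ _ (\int[mu]_s (r * (s / (s2 + w1 * s) - K * (1 / (s2 + w1 * s)))))).
  apply: supp_le => // s s0 sM; rewrite -subr_le0.
  have -> : s / (s2 + w2 * s) - K * (1 / (s2 + w2 * s)) -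
      r * (s / (s2 + w1 * s) - K * (1 / (s2 + w1 * s))) =
      - (s2 * (w2 - w1) * (s - K) ^+ 2 /
         ((s2 + w2 * s) * (s2 + w1 * s) * (s2 + w2 * K))).
    by rewrite /r; field; rewrite !gt_eqF ?den_gt0.
  rewrite oppr_le0 divr_ge0//.
    by rewrite mulr_ge0 ?sqr_ge0// mulr_ge0 ?subr_ge0// ltW.
  by rewrite !mulr_ge0 ?ltW ?den_gt0.
rewrite RintegralZl//; last first.
  exact: (integrableB measurableT (iC w10) (integrableZl measurableT K (iA w10))).
rewrite RintegralB//; [|exact: iC|exact: (integrableZl measurableT K (iA w10))].
rewrite RintegralZl//; last exact: iA.
by rewrite -/(A w1) -/(C w1) /K divfK ?gt_eqF ?A_gt0// subrr mulr0.
Qed.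

(** [A w] is [u / w], and [AC] expresses [C w] through [A w]. With a positive denominator, the
    resulting quotient visibly increases with [u]. *)
Lemma LmapE_stieltjes (w : R) : 0 < w ->
  let u := \int[mu]_s (1 / (s + s2 / w)) in
  0 < w - s2 * u /\ Lmap s2 mu w = s2 * w * u / (w - s2 * u).
Proof.
move=> w0 u; have w0' := ltW w0.
have sw s : 0 <= s -> 0 < s + s2 / w by move=> s0; rewrite ltr_wpDl// divr_gt0.
have iu : mu.-integrable setT (EFin \o (fun s : R => 1 / (s + s2 / w))).
  apply: (supp_integrable (K := w / s2)).
    apply: measurable_funM => //; apply: measurable_funV; exact: measurable_funD.
  move=> s s0 sM; rewrite mul1r -[leRHS]invf_div gtr0_norm ?invr_gt0 ?sw//.
  by rewrite lef_pV2 ?posrE ?divr_gt0 ?sw// lerDr.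
have Au : A w = w^-1 * u.
  rewrite /u -RintegralZl//.
  apply: supp_eq; [exact: iA|exact: (integrableZl measurableT w^-1 iu)|].
  move=> s s0 sM; field; rewrite !gt_eqF ?den_gt0//.
  by rewrite ltr_wpDl// mulr_ge0.
have Cu : C w = (w - s2 * u) / w ^+ 2.
  have wC : w * C w = 1 - s2 * A w by rewrite -(AC w0') addrAC subrr add0r.
  apply: (@mulfI _ w); first by rewrite gt_eqF.
  by rewrite wC Au; field; rewrite gt_eqF.
have Dp : 0 < w - s2 * u.
  by have := C_gt0 w0'; rewrite Cu pmulr_lgt0// invr_gt0 exprn_gt0.
split => //; rewrite LmapE// Au Cu; field.
by rewrite !gt_eqF.
Qed.

End compactly_supported.

(** The maximality is also recorded over all [u] with [u <= L (extrinsic_mmse u)], because a fixed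
    point for a smaller [L] is only known to satisfy this inequality. *)
Lemma tauB_plus_exists (R : realType) (Pi mu : probability (measurableTypeR R) R) (s2 : R) :
  finite_second_moment Pi -> compact_support_nonneg mu -> 0 < \int[mu]_s s ->
  0 < s2 -> exists tau, is_tauB_plus s2 Pi mu tau /\
    forall u, 0 < u -> u <= Lmap s2 mu (extrinsic_mmse Pi u) -> u <= tau.
Proof.
move=> Pi2 [M S] mean s20.
have [|||t [t0 ft tmax]] := @max_fixpoint R (fun t => Lmap s2 mu (extrinsic_mmse Pi t))
  (Lmap s2 mu 0) (Lmap s2 mu (\int[Pi]_b (b ^+ 2))).
- exact: Lmap0_gt0.
- move=> t t0; apply/andP; split; apply: (Lmap_nondecreasing S) => //.
  + exact: extrinsic_mmse_ge0.
  + exact: extrinsic_mmse_ge0.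
  + exact: extrinsic_mmse_le.
- move=> t u t0 tu; apply: (Lmap_nondecreasing S) => //.
  + exact: extrinsic_mmse_ge0.
  + exact: extrinsic_mmse_nondecreasing.
exists t; split => //; split => //.
by move=> u [u0 fu]; apply: tmax => //; rewrite fu.
Qed.

Section stieltjes_order.
Context (R : realType) (mu1 mu2 : probability (measurableTypeR R) R).
Hypotheses (supp1 : compact_support_nonneg mu1) (supp2 : compact_support_nonneg mu2).
Hypotheses (mean1 : 0 < \int[mu1]_s s) (mean2 : 0 < \int[mu2]_s s).
Hypothesis mu12 : stieltjes_ge mu2 mu1.

Lemma stieltjes_ge_Lmap (s2 w : R) : 0 < s2 -> 0 < w ->
  Lmap s2 mu1 w <= Lmap s2 mu2 w.
Proof.
move=> s20 w0; case: supp1 => M1 S1; case: supp2 => M2 S2.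
have [d1 ->] := LmapE_stieltjes S1 mean1 s20 w0.
have [d2 ->] := LmapE_stieltjes S2 mean2 s20 w0.
have := mu12 (divr_gt0 s20 w0); set u1 := \int[mu1]_s _; set u2 := \int[mu2]_s _.
move=> u12.
rewrite ler_pdivrMr// [leRHS]mulrAC ler_pdivlMr//.
rewrite -subr_ge0 (_ : _ - _ = s2 * w ^+ 2 * (u2 - u1)); last by ring.
by rewrite !mulr_ge0 ?subr_ge0 ?sqr_ge0// ltW.
Qed.

Lemma stieltjes_ge_mmse (Pi : probability (measurableTypeR R) R) (s2 : R) :
  finite_second_moment Pi -> 0 < s2 ->
  exists tau1 tau2 : R, [/\ is_tauB_plus s2 Pi mu1 tau1,
    is_tauB_plus s2 Pi mu2 tau2 & mmse Pi tau1 <= mmse Pi tau2].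
Proof.
move=> Pi2 s20.
have [t1 [T1 _]] := tauB_plus_exists Pi2 supp1 mean1 s20.
have [t2 [T2 max2]] := tauB_plus_exists Pi2 supp2 mean2 s20.
exists t1, t2; split; [exact: T1|exact: T2|].
have [[t10 f1] _] := T1.
(* At [w = 0] the Stieltjes order yields no comparison, but then [mmse Pi t1] is 0 and the
   conclusion is immediate. *)
have [E0|E0] := eqVneq (extrinsic_mmse Pi t1) 0.
  by rewrite (extrinsic_mmse_eq0 Pi2 t10 E0) mmse_ge0.
apply: (mmse_nondecreasing Pi2 t10); apply: max2 => //.
rewrite -{1}f1; apply: stieltjes_ge_Lmap => //.
by rewrite lt_neqAle eq_sym E0 extrinsic_mmse_ge0.
Qed.

End stieltjes_order.

(* Freeness applied to the word of length two [(a - phi a) (b - phi b)]. *)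
Lemma free_mul_convolution_mean (R : realType)
    (mu nu rho : probability (measurableTypeR R) R) :
  is_free_mul_convolution mu nu rho ->
  \int[rho]_s s = (\int[mu]_s s) * (\int[nu]_s s).
Proof.
move=> [_ _ _ [A [phi [a [b [phi1 free mom]]]]]].
have [pa pb pab] := mom 1%N; rewrite !expr1 in pa pb pab.
have momE (m : probability (measurableTypeR R) R) : moment m 1 = \int[m]_s s.
  by apply: eq_Rintegral => s _; rewrite expr1.
rewrite !momE in pa pb pab.
set ma := (X in _ = X) in pa; set mb := (X in _ = X) in pb.
have letterE (x : A) (c : R[i]) : horner_alg x ('X - c%:P) = x - c%:A.
  by rewrite rmorphB /= horner_algX horner_algC.
have phi_c (x : A) (c : R[i]) : phi (x - c%:A) = phi x - c.
  by rewrite linearB linearZ /= phi1 /GRing.scale/= mulr1.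
have := free [:: (true, 'X - ma%:P); (false, 'X - mb%:P)].
rewrite /= => /(_ isT isT).
have : forall x, x \in [:: (true, 'X - ma%:P); (false, 'X - mb%:P)] ->
    phi (horner_alg (if x.1 then a else b) x.2) = 0.
  move=> x; rewrite !inE => /orP[]/eqP -> /=; rewrite letterE phi_c.
    by rewrite pa subrr.
  by rewrite pb subrr.
move=> cent /(_ cent); rewrite !big_cons big_nil mulr1 /= !letterE.
rewrite mulrBl !mulrBr !mulr_algl mulr_algr !linearB !linearZ /= pa pb pab phi1.
have scE (c x : R[i]) : c *: (x : R[i]^o) = c * x by [].
rewrite !scE => E.
have {E} : (\int[rho]_s s)%:C%C = ma * mb.
  by apply/eqP; rewrite -subr_eq0 -[X in _ == X]E; apply/eqP; ring.
by rewrite -rmorphM => /complexI.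
Qed.

(** A law on [[0, M]] with zero mean is concentrated at 0, and a density gives the point 0 no
    mass. *)
Lemma density_mean_gt0 (R : realType) (nu : probability (measurableTypeR R) R) (f : R -> R) :
  has_density nu f -> compact_support_nonneg nu -> 0 < \int[nu]_s s.
Proof.
move=> dens [M S].
have id0 : nu.-integrable setT (EFin \o (fun s : R => s)).
  by apply: (supp_integrable S (K := M)) => // s s0 sM; rewrite ger0_norm.
have ge0 : 0 <= \int[nu]_s s.
  have <- : \int[nu]_s (0 : R) = 0 by rewrite Rintegral_cst// mul0r.
  apply: (supp_le S) => //; exact: finite_measure_integrable_cst.
rewrite lt_neqAle ge0 andbT; apply/eqP => m0.
have iabs : nu.-integrable setT (EFin \o (fun s : R => `|s|)).
  by apply: (supp_integrable S (K := M)) => // s s0 sM; rewrite normr_id ger0_norm.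
have absE : (\int[nu]_s `|s%:E| = 0)%E.
  rewrite -[LHS]fineK; last exact: (integrable_fin_num measurableT iabs).
  have absR : \int[nu]_s `|s| = \int[nu]_s s.
    by apply: (supp_eq S) => // s s0 sM; rewrite ger0_norm.
  by rewrite -m0 in absR; rewrite -[X in X%:E]/(\int[nu]_s `|s|) absR.
have [/(_ absE)[N [mN N0 subN]] _] := @ae_eq_integral_abs _ _ _ nu setT measurableT
  (EFin \o (fun s : R => s)) (measurable_int _ id0).
have nu0 : nu [set 0] = 0%E by rewrite dens// integral_set1.
have : (nu setT <= 0)%E.
  rewrite -[leRHS]adde0 -{1}N0 -nu0.
  apply: (@le_trans _ _ (nu (N `|` [set 0]))); last exact: measureU2.
  rewrite le_measure ?inE//; first exact: measurableU.
  move=> s _; have [->|s0] := eqVneq s 0; first by right.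
  by left; apply: subN => /= /(_ I) /eqP; rewrite /cst/= eqe (negbTE s0).
by rewrite [X in (X <= _)%E](_ : _ = 1%E) ?lee_fin ?ler10//; exact: probability_setT.
Qed.

(** * Resolvents of Gram matrices *)

Section resolvent.
Context (R : realType).

Lemma mulmx_row_tr (N : nat) (u : 'rV[R]_N) : (u *m u^T) 0 0 = \sum_j u 0 j ^+ 2.
Proof. by rewrite mxE; apply: eq_bigr => j _; rewrite mxE -expr2. Qed.

Lemma mxtrace_tr_mul_ge0 (m N : nat) (Z : 'M[R]_(m, N)) : 0 <= \tr (Z^T *m Z).
Proof.
rewrite /mxtrace sumr_ge0// => i _; rewrite mxE sumr_ge0// => j _.
by rewrite mxE -expr2 sqr_ge0.
Qed.

Definition resolvent (m N : nat) (c : R) (X : 'M[R]_(m, N)) : 'M[R]_N :=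
  invmx (X^T *m X + c%:M).

Context (m N : nat) (c : R) (c0 : 0 < c) (X : 'M[R]_(m, N)).
Let Q := resolvent c X.

(** A row [v] in the kernel satisfies [|X v^T|^2 + c |v|^2 = 0], so it vanishes. *)
Lemma gram_add_unit : X^T *m X + c%:M \in unitmx.
Proof.
rewrite -row_free_unit -kermx_eq0; apply/rowV0P => v /sub_kermxP.
rewrite mulmxDr mul_mx_scalar => /(congr1 (fun u => u *m v^T)).
rewrite mulmxDl mul0mx -scalemxAl => /(congr1 mxtrace).
rewrite linearD linearZ/= linear0.
have -> : v *m (X^T *m X) *m v^T = (X *m v^T)^T *m (X *m v^T).
  by rewrite trmx_mul trmxK !mulmxA.
rewrite -[X in c * \tr (X *m _)]trmxK => /eqP.
rewrite paddr_eq0 ?mxtrace_tr_mul_ge0//; last first.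
  by rewrite mulr_ge0 ?mxtrace_tr_mul_ge0// ltW.
move=> /andP[_]; rewrite mulf_eq0 gt_eqF//= trmxK /mxtrace big_ord1 mxE => /eqP E.
apply/rowP => j; rewrite mxE.
have S0 : \sum_k v 0 k ^+ 2 = 0.
  by rewrite -[RHS]E; apply: eq_bigr => k _; rewrite mxE expr2.
apply/eqP; rewrite -sqrf_eq0; apply/eqP; apply: (psumr_eq0P _ S0) => // k _.
exact: sqr_ge0.
Qed.

Lemma resolvent_sym : Q^T = Q.
Proof.
by rewrite /Q /resolvent trmx_inv linearD /= trmx_mul trmxK tr_scalar_mx.
Qed.

Lemma resolventK : Q *m (X^T *m X + c%:M) = 1%:M.
Proof. exact: mulVmx gram_add_unit. Qed.

Lemma resolventVK : (X^T *m X + c%:M) *m Q = 1%:M.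
Proof. exact: mulmxV gram_add_unit. Qed.

(* The map [Y |-> 2 tr Y - tr (Y^T (X^T X + c) Y)] is maximal at the resolvent. *)
Lemma resolvent_variational (Y : 'M[R]_N) :
  \tr Y *+ 2 - \tr (Y^T *m (X^T *m X + c%:M) *m Y) <= \tr Q.
Proof.
set B := X^T *m X + c%:M.
have psd (Z : 'M[R]_N) : 0 <= \tr (Z^T *m B *m Z).
  rewrite /B mulmxDr mulmxDl linearD /= addr_ge0//.
    rewrite (_ : _ *m _ = (X *m Z)^T *m (X *m Z)) ?mxtrace_tr_mul_ge0//.
    by rewrite trmx_mul !mulmxA.
  by rewrite mul_mx_scalar -scalemxAl linearZ /= mulr_ge0 ?mxtrace_tr_mul_ge0// ltW.
(* Completing the square: [Q B = B Q = 1] reduces the expansion to the [Y] terms and [Q]. *)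
have := psd (Y - Q).
have QB : Q *m B = 1%:M by exact: resolventK.
have BQ : B *m Q = 1%:M by exact: resolventVK.
have -> : (Y - Q)^T *m B *m (Y - Q) = Y^T *m B *m Y - Y - (Y^T - Q).
  rewrite [(Y - Q)^T]linearB /= resolvent_sym mulmxBl QB mulmxBr !mulmxBl !mul1mx.
  by rewrite -(mulmxA _ B Q) BQ mulmx1.
rewrite !linearB /= mxtrace_tr mulr2n; lra.
Qed.

(** Let [y] be row [i] of [X Q] and [z = y X^T]. Pairing [y (X^T X + c) = row i X] with [y] gives
    [|z|^2 + c |y|^2 = z_i], so [c |y|^2 <= z_i - z_i^2 <= 1/4]. *)
Lemma resolvent_row_bound (i : 'I_m) : \sum_k (X *m Q) i k ^+ 2 <= (4 * c)^-1.
Proof.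
pose y := row i (X *m Q).
have yE : y *m (X^T *m X + c%:M) = row i X.
  by rewrite /y row_mul -mulmxA resolventK mulmx1.
have -> : \sum_k (X *m Q) i k ^+ 2 = \sum_j y 0 j ^+ 2.
  by apply: eq_bigr => j _; rewrite !mxE.
set n2 := \sum_j _.
pose z := y *m X^T.
have key : \sum_j z 0 j ^+ 2 + c * n2 = z 0 i.
  have /(congr1 (fun u => (u *m y^T) 0 0)) := yE.
  rewrite /= mulmxDr mulmxDl mul_mx_scalar -scalemxAl [LHS]mxE [X in _ + X = _]mxE mulmx_row_tr -/n2.
  have -> : y *m (X^T *m X) *m y^T = z *m z^T by rewrite /z trmx_mul trmxK !mulmxA.
  by rewrite mulmx_row_tr => ->; rewrite !mxE; apply: eq_bigr => j _; rewrite !mxE mulrC.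
have zi : z 0 i ^+ 2 <= \sum_j z 0 j ^+ 2.
  by rewrite (bigD1 i)//= lerDl sumr_ge0// => k _; exact: sqr_ge0.
rewrite -div1r ler_pdivlMr ?mulr_gt0//.
have := sqr_ge0 (z 0 i - 2^-1); nra.
Qed.

(** The gradient at [S = 1] of [S |-> - tr (X^T S X + c)^-1]; a new layer replaces [S = 1] by
    [S = G^T G]. *)
Definition resolvent_weight : 'M[R]_m := X *m Q *m (X *m Q)^T.

(** The bound is uniform in [X], so the weights are integrable without moment estimates on the older
    layers. *)
Lemma resolvent_weight_bound (i j : 'I_m) : `|resolvent_weight i j| <= (4 * c)^-1.
Proof.
rewrite /resolvent_weight mxE.
have -> : \sum_j0 (X *m Q) i j0 * (X *m Q)^T j0 j = \sum_j0 (X *m Q) i j0 * (X *m Q) j j0.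
  by apply: eq_bigr => k _; rewrite [_^T _ _]mxE.
apply: le_trans (ler_norm_sum _ _ _) _.
apply: (@le_trans _ _ (\sum_k ((X *m Q) i k ^+ 2 + (X *m Q) j k ^+ 2) / 2)).
  apply: ler_sum => k _; rewrite normrM.
  rewrite -[_ i k ^+ 2]real_normK ?num_real// -[_ j k ^+ 2]real_normK ?num_real//.
  by have := sqr_ge0 (`|(X *m Q) i k| - `|(X *m Q) j k|); nra.
rewrite -mulr_suml big_split /=.
by have := resolvent_row_bound i; have := resolvent_row_bound j; lra.
Qed.

End resolvent.

(* The subtracted term is [tr ((G^T G - 1) W)] with [W] the resolvent weight. *)
Lemma resolvent_mul_ge (R : realType) (m' m N : nat) (c : R) (c0 : 0 < c)
    (X : 'M[R]_(m, N)) (G : 'M[R]_(m', m)) :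
  \tr (resolvent c X) -
    (\sum_i \sum_j (\sum_l G l i * G l j) * resolvent_weight c X i j -
     \sum_i resolvent_weight c X i i)
    <= \tr (resolvent c (G *m X)).
Proof.
set W := resolvent_weight c X; set Q := resolvent c X.
have QT : Q^T = Q by exact: resolvent_sym.
apply: le_trans (resolvent_variational c0 (G *m X) Q).
have quad (m1 : nat) (Y : 'M[R]_(m1, N)) :
    \tr (Q^T *m (Y^T *m Y + c%:M) *m Q) = \tr ((Y *m Q) *m (Y *m Q)^T) + c * \tr (Q *m Q).
  rewrite mulmxDr mulmxDl linearD /= mul_mx_scalar -scalemxAl linearZ /= QT.
  by congr (_ + _); rewrite [RHS]mxtrace_mulC trmx_mul QT !mulmxA.
(* The identity [Q B Q = Q] eliminates the term [c * \tr (Q *m Q)], common to [X] and [G X]. *)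
have trQ : \tr Q = \tr W + c * \tr (Q *m Q).
  by rewrite /W /resolvent_weight -quad QT (resolventK c0 X) mul1mx.
have trG : \tr ((G *m X *m Q) *m (G *m X *m Q)^T) =
    \sum_i \sum_j (\sum_l G l i * G l j) * W i j.
  have -> : G *m X *m Q *m (G *m X *m Q)^T = G *m W *m G^T.
    by rewrite /W /resolvent_weight -/Q -(mulmxA G X) (trmx_mul G) !mulmxA.
  transitivity (\sum_l \sum_j (\sum_i G l i * W i j) * G l j).
    by apply: eq_bigr => l _; rewrite mxE; apply: eq_bigr => j _; rewrite !mxE.
  transitivity (\sum_l \sum_i \sum_j G l i * W i j * G l j).
    apply: eq_bigr => l _; rewrite exchange_big /=.
    by apply: eq_bigr => j _; rewrite mulr_suml.
  rewrite exchange_big; apply: eq_bigr => i _; rewrite exchange_big.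
  apply: eq_bigr => j _; rewrite mulr_suml; apply: eq_bigr => l _.
  by rewrite mulrAC.
rewrite quad trG -/(mxtrace W) trQ mulr2n; lra.
Qed.

(** * Spectra of symmetric and Gram matrices *)

Section spectral.
Context (R : realType) (N : nat) (M : 'M[R]_N).
Hypothesis Msym : M^T = M.
Local Notation rc := (real_complex R).

Lemma char_poly_conj (F : fieldType) (n : nat) (U D : 'M[F]_n) : U \in unitmx ->
  char_poly (invmx U *m D *m U) = char_poly D.
Proof.
move=> Uu; rewrite /char_poly /char_poly_mx !map_mxM /=.
have UK : map_mx polyC (invmx U) *m map_mx polyC U = 1%:M.
  by rewrite -map_mxM mulVmx// map_mx1.
have -> : 'X%:M - map_mx polyC (invmx U) *m map_mx polyC D *m map_mx polyC U =
   map_mx polyC (invmx U) *m ('X%:M - map_mx polyC D) *m map_mx polyC U.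
  rewrite mulmxBr mulmxBl mul_mx_scalar -scalemxAl UK.
  by rewrite scalemx1.
by rewrite !det_mulmx mulrAC -det_mulmx UK det1 mul1r.
Qed.

(** Diagonalization takes place over [R[i]] and descends to [R] because a hermitian matrix has real
    eigenvalues. The same [r] serves both claims, which links the characteristic polynomial to the
    resolvent trace. *)
Lemma sym_spectral : exists r : 'rV[R]_N,
  char_poly M = \prod_i ('X - (r 0 i)%:P) /\
  forall c : R, (forall i, r 0 i + c != 0) ->
    \tr (invmx (M + c%:M)) = \sum_i (r 0 i + c)^-1.
Proof.
pose MC := map_mx rc M.
have Mreal : MC \is a realmx.
  by apply/mxOverP => i j; rewrite mxE; apply/complex_realP; exists (M i j).
have Mh : MC \is hermsymmx.
  apply: realsym_hermsym Mreal.
  apply/is_hermitianmxP; rewrite expr0 scale1r; apply/matrixP => i j.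
  by rewrite !mxE -[in LHS]Msym mxE.
have Mn := hermitian_normalmx Mh.
have /orthomx_spectralP ME := Mn.
have spr := hermitian_spectral_diag_real Mh.
set U := spectralmx MC in ME; set sp := spectral_diag MC in ME spr.
have Uu : U \in unitmx by exact: spectral_unit.
pose r : 'rV[R]_N := map_mx (@complex.Re R) sp.
have spE i : sp 0 i = rc (r 0 i).
  have /mxOverP/(_ 0 i)/complex_realP[x xE] := spr.
  by rewrite /r mxE xE.
exists r; split.
  apply: (@map_poly_inj _ _ rc).
  rewrite map_char_poly -/MC ME char_poly_conj//.
  rewrite char_poly_trig ?diag_mx_is_trig// rmorph_prod /=.
  apply: eq_bigr => i _.
  by rewrite mxE eqxx mulr1n spE rmorphB /= map_polyX map_polyC.
move=> c rc0.
apply: (@complexI R); rewrite -[LHS](trace_map_mx rc) map_invmx.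
rewrite map_mxD map_scalar_mx -/MC.
pose cc := rc c.
pose D' : 'rV[R[i]]_N := \row_i (sp 0 i + cc)^-1.
have UK : U *m invmx U = 1%:M by exact: mulmxV.
have UK' : invmx U *m U = 1%:M by exact: mulVmx.
have ME' : MC + cc%:M = invmx U *m diag_mx (sp + const_mx cc) *m U.
  rewrite raddfD /= diag_const_mx mulmxDr mulmxDl -ME; congr (_ + _).
  by rewrite mul_mx_scalar -scalemxAl UK' scalemx1.
have inv1 : (MC + cc%:M) *m (invmx U *m diag_mx D' *m U) = 1%:M.
  rewrite ME' !mulmxA -(mulmxA _ U) UK mulmx1 -(mulmxA (invmx U)) mulmx_diag.
  rewrite (_ : \row__ _ = const_mx 1) ?diag_const_mx ?mulmx1//.
  apply/rowP => i; rewrite !mxE divff// spE -rmorphD fmorph_eq0.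
  exact: rc0.
have [Au _] := mulmx1_unit inv1.
have -> : invmx (MC + cc%:M) = invmx U *m diag_mx D' *m U.
  exact: (etrans (esym (mulmx1 _)) (etrans (congr1 (mulmx _) (esym inv1)) (mulKmx Au _))).
rewrite mxtrace_mulC mulmxA UK mul1mx mxtrace_diag rmorph_sum /=.
by apply: eq_bigr => i _; rewrite mxE spE fmorphV rmorphD.
Qed.

End spectral.

Section gram_eigenvalues.
Context (R : realType) (m N : nat) (X : 'M[R]_(m, N)).

Let gram_sym : (X^T *m X)^T = X^T *m X. Proof. by rewrite trmx_mul trmxK. Qed.

Lemma gram_root_ge0 (x : R) : root (char_poly (X^T *m X)) x -> 0 <= x.
Proof.
rewrite -eigenvalue_root_char => /eigenvalueP[v vE v0].
have /(congr1 (fun u => (u *m v^T) 0 0)) /= := vE.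
have -> : v *m (X^T *m X) *m v^T = (v *m X^T) *m (v *m X^T)^T.
  by rewrite trmx_mul trmxK !mulmxA.
rewrite -scalemxAl [RHS]mxE !mulmx_row_tr => E.
have vp : 0 < \sum_j v 0 j ^+ 2.
  rewrite lt_neqAle sumr_ge0 ?andbT; last by move=> j _; exact: sqr_ge0.
  apply: contra v0 => /eqP S0; apply/eqP/rowP => j; rewrite mxE.
  apply/eqP; rewrite -sqrf_eq0; apply/eqP.
  by apply: (psumr_eq0P _ (esym S0)) => // k _; exact: sqr_ge0.
rewrite -(pmulr_lge0 _ vp) -E sumr_ge0// => j _; exact: sqr_ge0.
Qed.

(** The diagonalization shows that the characteristic polynomial splits, so [xget] returns true
    roots; unique factorization makes them a permutation of the diagonal entries. *)
Lemma gram_eigenvalues (c : R) (s := eigenvalues (X^T *m X)) : 0 < c ->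
  [/\ size s = N, forall x, x \in s -> 0 <= x &
      \tr (resolvent c X) = \sum_(x <- s) (x + c)^-1].
Proof.
move=> c0; have [r [rE rtr]] := sym_spectral gram_sym.
pose t := [seq r 0 i | i <- index_enum 'I_N].
have tE : char_poly (X^T *m X) = \prod_(x <- t) ('X - x%:P) by rewrite big_map.
have sE : char_poly (X^T *m X) = \prod_(x <- s) ('X - x%:P).
  exact: (@xgetI _ [::] [set s | char_poly (X^T *m X) = \prod_(x <- s) ('X - x%:P)] t tE).
have st : perm_eq s t by apply: prod_XsubC_eq; rewrite -sE -tE.
have s0 x : x \in s -> 0 <= x.
  by move=> xs; apply: gram_root_ge0; rewrite sE root_prod_XsubC.
split => //.
  by rewrite (perm_size st) size_map [index_enum _]unlock -enumT size_enum_ord.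
rewrite rtr; last first.
  move=> i; rewrite gt_eqF// ltr_wpDl// s0// (perm_mem st) map_f//.
  by rewrite mem_index_enum.
by rewrite (perm_big _ st) big_map.
Qed.

Lemma resolvent_trace_bound (c : R) : 0 < c -> 0 <= \tr (resolvent c X) <= N%:R / c.
Proof.
move=> c0; have [sN s0 ->] := gram_eigenvalues c0; apply/andP; split.
  rewrite big_seq sumr_ge0// => x xs; rewrite invr_ge0 addr_ge0//; [exact: s0|exact: ltW].
rewrite (_ : N%:R / c = \sum_(x <- eigenvalues (X^T *m X)) c^-1); last first.
  by rewrite big_const_seq iter_addr_0 count_predT sN mulr_natl.
rewrite big_seq [leRHS]big_seq.
apply: ler_sum => x xs; rewrite lef_pV2 ?posrE ?ltr_wpDl ?s0// lerDr.
exact: s0.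
Qed.

End gram_eigenvalues.

(** * Measurability of matrix operations *)

Section measurable_matrix.
Context d (T : measurableType d) (R : realType).

Definition measurable_mx (m n : nat) (A : T -> 'M[R]_(m, n)) : Prop :=
  forall i j, measurable_fun setT (fun w => A w i j).

Lemma measurable_mx_mul (m n p : nat) (A : T -> 'M[R]_(m, n)) (B : T -> 'M[R]_(n, p)) :
  measurable_mx A -> measurable_mx B -> measurable_mx (fun w => A w *m B w).
Proof.
move=> mA mB i j; under eq_fun do rewrite mxE.
by apply: measurable_sum => k; exact: measurable_funM.
Qed.

Lemma measurable_mx_tr (m n : nat) (A : T -> 'M[R]_(m, n)) :
  measurable_mx A -> measurable_mx (fun w => (A w)^T).
Proof. by move=> mA i j; under eq_fun do rewrite mxE; exact: mA. Qed.

Lemma measurable_mxtrace (n : nat) (A : T -> 'M[R]_n) :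
  measurable_mx A -> measurable_fun setT (fun w => \tr (A w)).
Proof. by move=> mA; apply: measurable_sum => i; exact: mA. Qed.

Lemma measurable_det (n : nat) (A : T -> 'M[R]_n) :
  measurable_mx A -> measurable_fun setT (fun w => \det (A w)).
Proof.
move=> mA; apply: measurable_sum => s; apply: measurable_funM => //.
by apply: measurable_prod => i _; exact: mA.
Qed.

(** By the adjugate formula; invertibility for every [w] removes the case distinction in [invmx]. *)
Lemma measurable_mx_inv (n : nat) (A : T -> 'M[R]_n) :
  (forall w, A w \in unitmx) -> measurable_mx A ->
  measurable_mx (fun w => invmx (A w)).
Proof.
move=> uA mA i j; under eq_fun do rewrite /invmx uA mxE mxE.
apply: measurable_funM; first exact: measurable_funV (measurable_det mA).
apply: measurable_funM => //; apply: measurable_det => k l.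
by under eq_fun do rewrite !mxE; exact: mA.
Qed.

Lemma measurable_resolvent (m N : nat) (c : R) (X : T -> 'M[R]_(m, N)) :
  0 < c -> measurable_mx X -> measurable_mx (fun w => resolvent c (X w)).
Proof.
move=> c0 mX; apply: measurable_mx_inv => [w|i j].
  exact: gram_add_unit.
under eq_fun do rewrite mxE; apply: measurable_funD => //.
exact: (measurable_mx_mul (measurable_mx_tr mX) mX).
Qed.

Lemma measurable_resolvent_weight (m N : nat) (c : R) (X : T -> 'M[R]_(m, N)) :
  0 < c -> measurable_mx X -> measurable_mx (fun w => resolvent_weight c (X w)).
Proof.
move=> c0 mX.
have mXQ := measurable_mx_mul mX (measurable_resolvent c0 mX).
exact: (measurable_mx_mul mXQ (measurable_mx_tr mXQ)).
Qed.

End measurable_matrix.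

Lemma integral_empirical_spectral_law (R : realType) (N : nat) (M : 'M[R]_N) (f : R -> R) :
  measurable_fun setT f -> (forall x, 0 <= f x) ->
  \int[empirical_spectral_law M]_x f x = N%:R^-1 * \sum_(x <- eigenvalues M) f x.
Proof.
move=> mf f0; rewrite /Rintegral /empirical_spectral_law.
set s := eigenvalues M.
have mE : measurable_fun setT (EFin \o f) by exact/measurable_EFinP.
have fE0 (x : measurableTypeR R) : setT x -> (0 <= (f x)%:E)%E by rewrite lee_fin.
rewrite ge0_integral_mscale//=.
rewrite ge0_integral_measure_sum//.
rewrite (eq_bigr (fun i : 'I_(size s) => (f (nth 0 s i))%:E)); last first.
  by move=> i _; rewrite integral_dirac// diracT mul1e.
rewrite sumEFin -EFinM /=; congr (_ * _).
by rewrite [RHS](big_nth 0) big_mkord.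
Qed.

(* [Num.max x 0] turns [x |-> (x + c)^-1] into a bounded continuous test function on the line;
   Gram matrices have no negative eigenvalues. *)
Lemma integral_spectral_gram (R : realType) (m N : nat) (X : 'M[R]_(m, N)) (c : R) :
  0 < c ->
  \int[empirical_spectral_law (X^T *m X)]_x (Num.max x 0 + c)^-1 =
  N%:R^-1 * \tr (resolvent c X).
Proof.
move=> c0; rewrite integral_empirical_spectral_law.
- have [_ s0 ->] := gram_eigenvalues X c0; congr (_ * _).
  by apply: eq_big_seq => x /s0 x0; rewrite max_l.
- by apply: measurable_funV; apply: measurable_funD => //; exact: measurable_maxr.
- by move=> x; rewrite invr_ge0 addr_ge0 ?le_max ?lexx ?orbT// ltW.
Qed.

(** * Independence *)

Section independence.
Context d (T : measurableType d) (R : realType) (P : probability T R).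

(** As functions of [E], both sides are finite measures, and they agree on the generating pi-system
    [G]. *)
Lemma independent_g_sigma_algebra (G : set (set T)) (F : set T) :
  G `<=` measurable -> setI_closed G -> G setT -> measurable F ->
  (forall E, G E -> P (E `&` F) = (P E * P F)%E) ->
  forall E, <<s G >> E -> P (E `&` F) = (P E * P F)%E.
Proof.
move=> Gm GI GT mF GF E sGE.
have PF0 : 0 <= fine (P F) by rewrite fine_ge0.
pose m1 := mrestr P mF.
pose m2 := mscale (NngNum PF0) P.
have PFE : ((fine (P F))%:E = P F)%E by rewrite fineK// fin_num_measure.
have m2E A : m2 A = (P A * P F)%E by rewrite /m2/= /mscale/= PFE muleC.
rewrite -m2E; apply: (g_sigma_algebra_measure_unique G Gm (fun=> setT) _ _ m1 m2) => //.
- by rewrite bigcup_const//; exists 0%N.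
- by move=> A GA; transitivity (P A * P F)%E; [exact: GF|exact/esym/m2E].
- move=> _; rewrite /m1/= /mrestr/= setTI.
  by rewrite (le_lt_trans (probability_le1 P mF))// ltry.
Qed.

Lemma independent_g_sigma_algebra2 (G H : set (set T)) :
  G `<=` measurable -> setI_closed G -> G setT ->
  H `<=` measurable -> setI_closed H -> H setT ->
  (forall E F, G E -> H F -> P (E `&` F) = (P E * P F)%E) ->
  forall E F, <<s G >> E -> <<s H >> F -> P (E `&` F) = (P E * P F)%E.
Proof.
move=> Gm GI GT Hm HI HT GH E F sE sF.
have sGm : <<s G >> `<=` measurable.
  by apply: smallest_sub => //; exact: sigma_algebra_measurable.
rewrite setIC muleC.
apply: (independent_g_sigma_algebra Hm HI HT (sGm _ sE)) => // F' HF'.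
rewrite setIC muleC; apply: (independent_g_sigma_algebra Gm GI GT (Hm _ HF')) => // E' GE'.
exact: GH.
Qed.

(** Independence makes the law of [(W, V)] the product of its marginals, and Fubini factors the
    integral of [x * y]. *)
Lemma independent_expectationM (W V : T -> R) :
  measurable_fun setT W -> measurable_fun setT V ->
  (forall A B, measurable A -> measurable B ->
     P (W @^-1` A `&` V @^-1` B) = (P (W @^-1` A) * P (V @^-1` B))%E) ->
  P.-integrable setT (EFin \o W) -> P.-integrable setT (EFin \o V) ->
  P.-integrable setT (EFin \o (fun w => W w * V w)) /\
  \int[P]_w (W w * V w) = (\int[P]_w W w) * (\int[P]_w V w).
Proof.
move=> mW mV ind iW iV.
pose W' : {mfun T >-> R} := HB.pack W (isMeasurableFun.Build _ _ _ _ W mW).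
pose V' : {mfun T >-> R} := HB.pack V (isMeasurableFun.Build _ _ _ _ V mV).
pose PW : probability R R := distribution P W'.
pose PV : probability R R := distribution P V'.
pose pr (w : T) := (W w, V w).
have mpr : measurable_fun setT pr by exact: measurable_fun_pair.
pose pr' : {mfun T >-> (R * R)%type} := HB.pack pr (isMeasurableFun.Build _ _ _ _ pr mpr).
pose PP : probability (R * R)%type R := distribution P pr'.
have prE (X : set (R * R)) : measurable X -> (PW \x PV)%E X = PP X.
  apply: (product_measure_unique (m' := PP)) => A B mA mB.
  by rewrite -ind.
have m1 : measurable_fun setT (fun z : R * R => z.1) by exact: measurable_fst.
have m2 : measurable_fun setT (fun z : R * R => z.2) by exact: measurable_snd.
have mf : measurable_fun setT (fun z : R * R => (z.1 * z.2)%:E).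
  by apply/measurable_EFinP; exact: measurable_funM.
have iPW : PW.-integrable setT (EFin \o (fun x : R => x)).
  apply: (integrable_pushforward mW) => //; exact/measurable_EFinP.
have iPV : PV.-integrable setT (EFin \o (fun x : R => x)).
  apply: (integrable_pushforward mV) => //; exact/measurable_EFinP.
have absPV : (\int[PV]_y `|y%:E| \is a fin_num)%E.
  by apply: (integrable_fin_num measurableT); exact: integrable_abse.
have absPW : (\int[PW]_x `|x%:E| \is a fin_num)%E.
  by apply: (integrable_fin_num measurableT); exact: integrable_abse.
have iprod : (PW \x PV)%E.-integrable setT (fun z : R * R => (z.1 * z.2)%:E).
  apply/(integrable12ltyP PW PV mf).
  rewrite (eq_integral (fun x : R => (`|x%:E| * \int[PV]_y `|y%:E|)%E)); last first.
    move=> x _; rewrite -ge0_integralZl//; last by apply: measurableT_comp.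
    by apply: eq_integral => y _; rewrite EFinM abseM.
  rewrite ge0_integralZr//.
  - by rewrite -(fineK absPV) -(fineK absPW) -EFinM ltry.
  - exact: measurableT_comp.
  - exact: integral_ge0.
have eqm (g : R * R -> \bar R) : (\int[PW \x PV]_z g z = \int[PP]_z g z)%E.
  by apply: eq_measure_integral => X mX _; exact: prE.
have iWV : P.-integrable setT (EFin \o (fun w => W w * V w)).
  apply/integrableP; split; first by apply/measurable_EFinP; exact: measurable_funM.
  have /integrableP[_] := iprod; rewrite eqm /PP /distribution.
  rewrite (ge0_integral_pushforward mpr)//.
  by apply: measurableT_comp.
split => //.
have -> : \int[P]_w W w = fine (\int[PW]_x x%:E).
  by rewrite (integral_pushforward mW)//; exact/measurable_EFinP.
have -> : \int[P]_w V w = fine (\int[PV]_x x%:E).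
  by rewrite (integral_pushforward mV)//; exact/measurable_EFinP.
rewrite -fineM; [|exact: (integrable_fin_num measurableT iPW)
                 |exact: (integrable_fin_num measurableT iPV)].
congr fine.
transitivity (\int[PP]_z (z.1 * z.2)%:E)%E.
  by rewrite (integral_pushforward mpr mf).
rewrite -eqm -(integral12_prod_meas1 iprod) /fubini_F /=.
rewrite (eq_integral (fun x : R => (x%:E * \int[PV]_y y%:E)%E)); last first.
  move=> x _; under eq_integral do rewrite EFinM.
  exact: integralZl.
have fV := integrable_fin_num measurableT iPV.
by rewrite -(fineK fV) integralZr.
Qed.

End independence.

Section independent_blocks.
Context d (T : measurableType d) (R : realType) (P : probability T R).
Context (I : eqType) (X : I -> {RV P >-> R}).
Hypothesis indep : mutually_independent X.

(** A pi-system for the sigma-algebra of the coordinates in [J], made of the events that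
    [mutually_independent] factors. *)
Definition cylinders (J : pred I) : set (set T) :=
  [set E | exists (s : seq I) (A : I -> set R),
    [/\ uniq s, all J s, forall i, measurable (A i) &
        E = \big[setI/setT]_(i <- s) (X i @^-1` A i)]].

Let bigsetIP (s : seq I) (F : I -> set T) (w : T) :
  (\big[setI/setT]_(i <- s) F i) w <-> (forall i, i \in s -> F i w).
Proof.
elim: s => [|j s IHs]; first by rewrite big_nil.
rewrite big_cons; split => [[Fj /IHs Fs] i|Fs].
  by rewrite inE => /predU1P[->//|]; exact: Fs.
split; first by apply: Fs; rewrite mem_head.
by apply/IHs => i si; apply: Fs; rewrite inE si orbT.
Qed.

Lemma cylinders_measurable J : cylinders J `<=` measurable.
Proof.
move=> _ [s [A [_ _ mA ->]]].
apply: bigsetI_measurable => i _.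
by rewrite -[X in measurable X]setTI; exact: (measurable_funP (X i)).
Qed.

Lemma cylinders_setT J : cylinders J setT.
Proof. by exists [::], (fun=> setT); split => //; rewrite big_nil. Qed.

Lemma cylinders_setI J : setI_closed (cylinders J).
Proof.
move=> _ _ [s [A [us Js mA ->]]] [t [B [ut Jt mB ->]]].
(* A shared coordinate must occur only once and carry both constraints; a list that lacks it
   contributes [setT]. *)
exists (undup (s ++ t)), (fun i => (if i \in s then A i else setT) `&`
                                   (if i \in t then B i else setT)).
split.
- exact: undup_uniq.
- apply/allP => i; rewrite mem_undup mem_cat => /orP[]; exact: allP i.
- by move=> i; apply: measurableI; case: ifP.
- apply/seteqP; split => w.
    move=> [/bigsetIP wA /bigsetIP wB]; apply/bigsetIP => i _.
    by split; case: ifP => //= h; [exact: wA|exact: wB].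
  move=> /bigsetIP wAB; split; apply/bigsetIP => i ii.
    have := wAB i; rewrite /= mem_undup mem_cat ii => /(_ isT) [+ _].
    by [].
  have := wAB i; rewrite /= mem_undup mem_cat ii orbT => /(_ isT) [_ +].
  by [].
Qed.

Lemma cylinders_independent (J1 J2 : pred I) (E F : set T) :
  (forall i, J1 i -> ~~ J2 i) -> cylinders J1 E -> cylinders J2 F ->
  P (E `&` F) = (P E * P F)%E.
Proof.
move=> J12 [s [A [us Js mA ->]]] [t [B [ut Jt mB ->]]].
(* The two lists are disjoint, so a single family describes both events and the concatenated list
   stays duplicate-free. *)
pose C i := if i \in s then A i else B i.
have nst i : i \in t -> (i \in s) = false.
  move=> it; apply/negP => /(allP Js) /J12.
  by rewrite (allP Jt _ it).
have EC : \big[setI/setT]_(i <- s) (X i @^-1` A i) = \big[setI/setT]_(i <- s) (X i @^-1` C i).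
  by apply: eq_big_seq => i; rewrite /C => ->.
have FC : \big[setI/setT]_(i <- t) (X i @^-1` B i) = \big[setI/setT]_(i <- t) (X i @^-1` C i).
  by apply: eq_big_seq => i it; rewrite /C nst.
have mC i : measurable (C i) by rewrite /C; case: ifP.
rewrite EC FC -big_cat /= !indep// ?big_cat//.
rewrite cat_uniq us ut andbT /=; apply/hasPn => i it /=.
by rewrite nst.
Qed.

Lemma cylinders_coordinate (J : pred I) (i : I) : J i ->
  measurable_fun setT (X i : g_sigma_algebraType (cylinders J) -> R).
Proof.
move=> Ji _ A mA; rewrite setTI; apply: sub_gen_smallest.
exists [:: i], (fun=> A); split => //=; first by rewrite Ji.
by rewrite big_seq1.
Qed.

(** Measurability for the sigma-algebra generated by the cylinders expresses that a variable depends
    on the coordinates of its block only. *)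
Lemma independent_blocks (J1 J2 : pred I) (W V : T -> R) :
  (forall i, J1 i -> ~~ J2 i) ->
  measurable_fun setT (W : g_sigma_algebraType (cylinders J1) -> R) ->
  measurable_fun setT (V : g_sigma_algebraType (cylinders J2) -> R) ->
  P.-integrable setT (EFin \o W) -> P.-integrable setT (EFin \o V) ->
  P.-integrable setT (EFin \o (fun w => W w * V w)) /\
  \int[P]_w (W w * V w) = (\int[P]_w W w) * (\int[P]_w V w).
Proof.
move=> J12 mW mV iW iV.
have /measurable_EFinP mW' := measurable_int _ iW.
have /measurable_EFinP mV' := measurable_int _ iV.
apply: independent_expectationM => // A B mA mB.
apply: (independent_g_sigma_algebra2 (G := cylinders J1) (H := cylinders J2)).
- exact: cylinders_measurable.
- exact: cylinders_setI.
- exact: cylinders_setT.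
- exact: cylinders_measurable.
- exact: cylinders_setI.
- exact: cylinders_setT.
- by move=> E F; exact: cylinders_independent.
- by have := mW measurableT A mA; rewrite setTI.
- by have := mV measurableT B mB; rewrite setTI.
Qed.

End independent_blocks.

Section expectation.
Context d (T : measurableType d) (R : realType) (P : probability T R).

Lemma bounded_integrable (f : T -> R) (K : R) : measurable_fun setT f ->
  (forall w, `|f w| <= K) -> P.-integrable setT (EFin \o f).
Proof.
move=> mf fK; apply: (@le_integrable _ _ _ P setT measurableT _ (EFin \o cst K)).
- exact/measurable_EFinP.
- by move=> w _; rewrite lee_fin (le_trans (fK w))// ler_norm.
- exact: finite_measure_integrable_cst.
Qed.

Lemma Rintegral_sum (I : Type) (s : seq I) (f : I -> T -> R) :
  (forall i, P.-integrable setT (EFin \o f i)) ->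
  P.-integrable setT (EFin \o (fun w => \sum_(i <- s) f i w)) /\
  \int[P]_w (\sum_(i <- s) f i w) = \sum_(i <- s) \int[P]_w f i w.
Proof.
move=> jf; elim: s => [|i s [IH1 IH2]].
  split; first by under eq_fun do rewrite big_nil; exact: finite_measure_integrable_cst.
  under eq_Rintegral do rewrite big_nil.
  by rewrite big_nil Rintegral_cst// mul0r.
split.
  under eq_fun do rewrite big_cons.
  exact: (integrableD measurableT (jf i) IH1).
under eq_Rintegral do rewrite big_cons.
by rewrite RintegralD// big_cons IH2.
Qed.

End expectation.

(** The map [f] allows a change of sigma-algebra: with [f = id] from a coarser structure, the lemma
    says that the product depends on the layers below [k] only. *)
Lemma measurable_layer_product d (T : measurableType d) (R : realType)
    (P : probability T R) (n : nat -> nat) (G : layers P n)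
    d' (T' : measurableType d') (f : T' -> T) (k : nat) :
  (forall l i j, (l < k)%N -> measurable_fun setT (fun x => G l i j (f x))) ->
  measurable_mx (fun x => layer_product G k (f x)).
Proof.
elim: k => [_ i j|k IHk mG] /=.
  by under eq_fun do rewrite mxE; exact: measurable_cst.
apply: measurable_mx_mul; last by apply: IHk => l i j lk; apply: mG; exact: ltnW.
by move=> i j; under eq_fun do rewrite mxE; apply: mG.
Qed.

(** * The Stieltjes order *)

Section expected_resolvent.
Context d (T : measurableType d) (R : realType) (P : probability T R).
Context (n : nat -> nat) (G : layers P n) (hG : gaussian_layers G).
Context (k : nat) (nk0 : (0 < n k.+1)%N) (c : R) (c0 : 0 < c).

Arguments G : clear implicits.

Let X (w : T) := layer_product G k w.

Lemma measurable_resolvent_trace (j : nat) :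
  measurable_fun setT (fun w => \tr (resolvent c (layer_product G j w))).
Proof.
apply: measurable_mxtrace; apply: measurable_resolvent => //.
by apply: (measurable_layer_product (f := id)).
Qed.

Lemma resolvent_trace_integrable (j : nat) :
  P.-integrable setT (EFin \o (fun w => \tr (resolvent c (layer_product G j w)))).
Proof.
apply: (@bounded_integrable _ _ _ P _ ((n 0%N)%:R / c)); first exact: measurable_resolvent_trace.
move=> w; have /andP[t0 tle] := resolvent_trace_bound (layer_product G j w) c0.
by rewrite ger0_norm.
Qed.

Let x (l : 'I_(n k.+1)) (i : 'I_(n k)) : {l : nat & ('I_(n l.+1) * 'I_(n l))%type} :=
  existT _ k (l, i).

Let s : R := Num.sqrt ((n k.+1)%:R^-1).

Let s0 : 0 < s. Proof. by rewrite sqrtr_gt0 invr_gt0 ltr0n. Qed.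

Let GN l i (A : set R) : measurable A -> distribution P (G k l i) A = normal_prob 0 s A.
Proof. by move=> mA; have [H _] := hG; exact: H. Qed.

Let entry_mul (l : 'I_(n k.+1)) (i j : 'I_(n k)) :
  P.-integrable setT (EFin \o (fun w => G k l i w * G k l j w)) /\
  \int[P]_w (G k l i w * G k l j w) = (i == j)%:R * (n k.+1)%:R^-1.
Proof.
have [_ ind] := hG.
have [<-|ij] := eqVneq i j.
  have sq : (fun w => G k l i w * G k l i w) = (fun w => G k l i w ^+ 2).
    by apply/funext => w; rewrite expr2.
  rewrite sq; split; first exact: (normal_rv_sqr_integrable s0 (@GN l i)).
  rewrite /Rintegral (normal_rv_sqr s0 (@GN l i)) /= mul1r /s sqr_sqrtr//.
have [] := independent_blocks ind (J1 := pred1 (x l i)) (J2 := pred1 (x l j))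
  (W := G k l i) (V := G k l j).
- move=> y /= /eqP ->; rewrite /x.
  have := @eq_Tagged _ (fun l : nat => ('I_(n l.+1) * 'I_(n l))%type) (x l i) (l, j).
  by rewrite /x /= => ->; rewrite xpair_eqE eqxx.
- exact: (cylinders_coordinate (J := pred1 (x l i)) (X := layer_entry G) (eqxx (x l i))).
- exact: (cylinders_coordinate (J := pred1 (x l j)) (X := layer_entry G) (eqxx (x l j))).
- exact: (normal_rv_integrable s0 (@GN l i)).
- exact: (normal_rv_integrable s0 (@GN l j)).
move=> int1 ->; split => //.
by rewrite (normal_rv_mean s0 (@GN l i)) !mul0r.
Qed.

Let W (i j : 'I_(n k)) (w : T) := resolvent_weight c (X w) i j.

Let iW i j : P.-integrable setT (EFin \o W i j).
Proof.
apply: (@bounded_integrable _ _ _ P _ (4 * c)^-1).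
  apply: measurable_resolvent_weight => //.
  by apply: (measurable_layer_product (f := id)).
by move=> w; exact: resolvent_weight_bound.
Qed.

(** [W] is built from the layers of index below [k], while the step from [k] to [k.+1] multiplies by
    the layer of index [k]: the two blocks are disjoint. *)
Let weight_entry i j l :
  P.-integrable setT (EFin \o (fun w => W i j w * (G k l i w * G k l j w))) /\
  \int[P]_w (W i j w * (G k l i w * G k l j w)) =
  (\int[P]_w W i j w) * ((i == j)%:R * (n k.+1)%:R^-1).
Proof.
have [_ ind] := hG; have [iGG <-] := entry_mul l i j.
pose J1 (y : {l : nat & ('I_(n l.+1) * 'I_(n l))%type}) := (tag y < k)%N.
pose J2 (y : {l : nat & ('I_(n l.+1) * 'I_(n l))%type}) := tag y == k.
apply: (independent_blocks ind (J1 := J1) (J2 := J2)) => //.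
- by move=> y; rewrite /J1 /J2 ltn_neqAle => /andP[].
- pose T1 := g_sigma_algebraType (cylinders (layer_entry G) J1).
  have mX : @measurable_mx _ T1 R _ _ X.
    have := @measurable_layer_product _ _ _ P n G _ T1 id k; apply => l' i' j' l'k.
    exact: (cylinders_coordinate (J := J1) (X := layer_entry G) (i := existT _ l' (i', j'))).
  exact: (measurable_resolvent_weight c0 mX i j).
- apply: measurable_funM.
    exact: (cylinders_coordinate (J := J2) (X := layer_entry G) (i := x l i) (eqxx k)).
  exact: (cylinders_coordinate (J := J2) (X := layer_entry G) (i := x l j) (eqxx k)).
Qed.

Lemma expected_resolvent_trace_le :
  \int[P]_w \tr (resolvent c (layer_product G k w)) <=
  \int[P]_w \tr (resolvent c (layer_product G k.+1 w)).
Proof.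
pose H i j l (w : T) := W i j w * (G k l i w * G k l j w).
have H3 i j := Rintegral_sum (index_enum 'I_(n k.+1)) (fun l => (weight_entry i j l).1).
have H2 i := Rintegral_sum (index_enum 'I_(n k)) (fun j => (H3 i j).1).
have [iH1 H1] := Rintegral_sum (index_enum 'I_(n k)) (fun i => (H2 i).1).
have [iD D1] := Rintegral_sum (index_enum 'I_(n k)) (fun i => iW i i).
(* Only [i = j] survives, and the [n k.+1] rows contribute [(n k.+1)^-1] each; this needs a nonempty
   layer. *)
have HD : \int[P]_w (\sum_i \sum_j \sum_l H i j l w) = \int[P]_w (\sum_i W i i w).
  rewrite H1 D1; apply: eq_bigr => i _; rewrite (H2 i).2.
  rewrite (bigD1 i)//= big1 ?addr0 => [|j ji]; rewrite (H3 i _).2.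
    under eq_bigr do rewrite (weight_entry i _ _).2 eqxx mul1r.
    rewrite sumr_const card_ord -[LHS]mulr_natr -mulrA mulVf ?mulr1//.
    by rewrite pnatr_eq0 -lt0n.
  by apply: big1 => l _; rewrite (weight_entry i _ _).2 eq_sym (negbTE ji) mul0r mulr0.
have iQ := resolvent_trace_integrable k.
have iHD := integrableB measurableT iH1 iD.
(* Subtracting a term of zero expectation reduces the claim to the pointwise inequality
   [resolvent_mul_ge]. *)
have -> : \int[P]_w \tr (resolvent c (layer_product G k w)) =
  \int[P]_w (\tr (resolvent c (X w)) - (\sum_i \sum_j \sum_l H i j l w - \sum_i W i i w)).
  rewrite RintegralB// RintegralB//.
  by rewrite [X in _ = _ - (X - _)]HD subrr subr0.
apply: le_Rintegral => //.
- exact: (integrableB measurableT iQ iHD).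
- exact: resolvent_trace_integrable.
move=> w _ /=.
apply: le_trans (resolvent_mul_ge c0 (X w) (layer_matrix G k w)).
rewrite lerD2l lerN2 lerD2r le_eqVlt; apply/orP; left; apply/eqP.
apply: eq_bigr => i _; apply: eq_bigr => j _; rewrite mulr_suml.
by apply: eq_bigr => l _; rewrite [layer_matrix _ _ _ _ i]mxE [layer_matrix _ _ _ _ j]mxE mulrC.
Qed.

End expected_resolvent.

(** The deviation is below [e / 2] except on an event of small probability, where it is at most
    [K + |l|]. *)
Lemma cvg_in_probability_expectation d (T : measurableType d) (R : realType)
    (P : probability T R) (F : nat -> T -> R) (K l : R) :
  (forall p, measurable_fun setT (F p)) -> (forall p w, `|F p w| <= K) ->
  (forall e, 0 < e -> (fun p => P [set w | e <= `|F p w - l|]) @ \oo --> 0%E) ->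
  forall e, 0 < e -> \forall p \near \oo, `|\int[P]_w F p w - l| <= e.
Proof.
move=> mF FK cvP e e0.
pose D := K + `|l|.
have D0 : 0 <= D.
  by rewrite addr_ge0// (le_trans _ (FK 0%N point))// normr_ge0.
have D1 : 0 < D + 1 by rewrite ltr_wpDl.
have e2 : 0 < e / 2 by rewrite divr_gt0.
have iF p : P.-integrable setT (EFin \o F p) by exact: (@bounded_integrable _ _ _ P (F p) K (mF p) (FK p)).
have ic (a : R) : P.-integrable setT (EFin \o (fun _ => a)).
  exact: finite_measure_integrable_cst.
have Rc (a : R) : \int[P]_w a = a by exact: Rintegral_probability_cst.
(* The shift by 1 keeps the threshold meaningful when [D = 0]. *)
have de : 0 < e / 2 / (D + 1) by rewrite divr_gt0.
have /fine_cvg/cvgr_lt/(_ _ de) := cvP _ e2.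
apply: filterS => p Pp.
pose A := [set w | e / 2 <= `|F p w - l|].
have mA : measurable A.
  have mFl : measurable_fun setT (fun w => `|F p w - l|).
    by apply: measurableT_comp => //; exact: measurable_funB.
  have := measurable_fun_ler (measurable_cst (e / 2)) mFl measurableT (Y := [set true]).
  by rewrite setTI; apply.
have iA : P.-integrable setT (EFin \o (fun w => \1_A w : R)).
  apply: (@bounded_integrable _ _ _ P _ 1); first exact: measurable_indic.
  by move=> w; rewrite indicE; case: (_ \in _); rewrite ?normr1 ?normr0.
have jFl : P.-integrable setT (EFin \o (fun w => F p w - l)).
  exact: (integrableB measurableT (iF p) (ic l)).
have jR : P.-integrable setT (EFin \o (fun w => e / 2 + D * \1_A w)).
  exact: (integrableD measurableT (ic _) (integrableZl measurableT D iA)).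
have -> : \int[P]_w F p w - l = \int[P]_w (F p w - l) by rewrite RintegralB// Rc.
apply: (le_trans (le_normr_Rintegral measurableT jFl)).
apply: (@le_trans _ _ (\int[P]_w (e / 2 + D * \1_A w))).
  apply: le_Rintegral => //; first exact: (integrable_norm jFl).
  move=> w _; rewrite indicE; have [_|/negP wA] := boolP (w \in A).
    rewrite mulr1; apply: (@le_trans _ _ D); last by rewrite lerDr ltW.
    by rewrite (le_trans (ler_normB _ _))// lerD2r.
  rewrite mulr0 addr0 ltW// ltNge; apply/negP => eF.
  by apply: wA; rewrite inE.
rewrite RintegralD//; last exact: (integrableZl measurableT D iA).
rewrite Rc RintegralZl// /Rintegral integral_indic// setIT.
rewrite [leRHS](splitr e) lerD2l.
apply: (@le_trans _ _ (D * (e / 2 / (D + 1)))).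
  by rewrite ler_wpM2l// ltW.
by rewrite mulrA ler_pdivrMr// mulrC ler_pM2l// lerDl.
Qed.

(** * Passage to the limiting spectral laws *)

Section gram_limit.
Context (R : realType) (n : nat -> nat -> nat) (gamma : nat -> R).
Context (d : measure_display) (T : measurableType d) (P : probability T R).
Context (G : forall p : nat, layers P (n p)).
Arguments G : clear implicits.
Hypothesis hG : forall p : nat, gaussian_layers (G p).

Lemma gram_limit_resolvent (mu : probability (measurableTypeR R) R) (j : nat) (c : R) :
  0 < c -> compact_support_nonneg mu ->
  weak_cvg_in_probability P
    (fun (p : nat) (w : T) => empirical_spectral_law (gram (G p) j w)) mu ->
  forall e : R, 0 < e -> \forall p \near \oo,
    `|\int[P]_w ((n p 0%N)%:R^-1 * \tr (resolvent c (layer_product (G p) j w))) -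
      \int[mu]_s (1 / (s + c))| <= e.
Proof.
move=> c0 [M S] cvg.
pose f (x : R) := (Num.max x 0 + c)^-1.
have den x : 0 < Num.max x 0 + c by rewrite ltr_wpDl// le_max lexx orbT.
have flec x : `|f x| <= c^-1.
  rewrite gtr0_norm ?invr_gt0// lef_pV2 ?posrE// lerDr.
  by rewrite le_max lexx orbT.
have fcont : continuous f.
  move=> x; apply: cvgV; first by rewrite gt_eqF.
  apply: cvgD; last exact: cvg_cst.
  apply: (@continuous_max _ _ _ _ x) ; [exact: cvg_id|exact: cvg_cst].
have mf : measurable_fun setT f by exact: continuous_measurable_fun.
have -> : \int[mu]_s (1 / (s + c)) = \int[mu]_s f s.
  apply: (supp_eq S).
  - apply: (supp_integrable S (K := c^-1)).
      apply: measurable_funM => //; apply: measurable_funV; exact: measurable_funD.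
    move=> s s0 _; rewrite mul1r gtr0_norm ?invr_gt0 ?ltr_wpDl//.
    by rewrite lef_pV2 ?posrE ?ltr_wpDl// lerDr.
  - by apply: (supp_integrable S (K := c^-1)).
  - by move=> s s0 _; rewrite /f max_l// mul1r.
apply: (cvg_in_probability_expectation (K := c^-1)).
- move=> p; apply: measurable_funM => //.
  by apply: measurable_resolvent_trace.
- move=> p w; have /andP[t0 tle] := resolvent_trace_bound (layer_product (G p) j w) c0.
  rewrite ger0_norm ?mulr_ge0 ?invr_ge0 ?ler0n//.
  move: (\tr _) t0 tle => t t0 tle; move: (n p 0%N) tle => N tle.
  (* For an empty matrix the normalized trace is 0, since [0^-1 = 0]. *)
  have [->|N0] := eqVneq N 0%N; first by rewrite invr0 mul0r invr_ge0 ltW.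
  by rewrite ler_pdivrMl ?ltr0n ?lt0n// (le_trans tle).
- move=> e e0.
  have := cvg f fcont (ex_intro _ c^-1 flec) e e0.
  apply: cvg_trans; apply: near_eq_cvg; apply: nearW => p.
  by congr (P _); apply/seteqP; split => w /=;
    rewrite /gram (integral_spectral_gram _ c0).
Qed.

Hypothesis hgamma : forall l : nat, (0 < l)%N -> 1 <= gamma l.
Hypothesis hn : forall l : nat, (0 < l)%N ->
  (fun p : nat => (n p l)%:R / p%:R : R) @ \oo --> gamma l.

(** Both Gram matrices have size [n p 0], so the normalization preserves the order of the expected
    traces; each limit then costs [e / 2]. *)
Lemma gram_limit_stieltjes_ge (mu : nat -> probability (measurableTypeR R) R) (k : nat) :
  compact_support_nonneg (mu k) -> compact_support_nonneg (mu k.+1) ->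
  (forall j : nat, (0 < j)%N -> weak_cvg_in_probability P
     (fun (p : nat) (w : T) => empirical_spectral_law (gram (G p) j w)) (mu j)) ->
  (0 < k)%N -> stieltjes_ge (mu k.+1) (mu k).
Proof.
move=> S1 S2 lim k0 c c0; apply/ler_addgt0Pr => e e0.
have e2 : 0 < e / 2 by rewrite divr_gt0.
have L1 := gram_limit_resolvent c0 S1 (lim _ k0) e2.
have L2 := gram_limit_resolvent c0 S2 (lim k.+1 isT) e2.
(* An empty layer would make the ratio 0, whereas its limit is at least 1. *)
have L3 : \forall p \near \oo, (0 < n p k.+1)%N.
  have g0 : 0 < gamma k.+1 by rewrite (lt_le_trans ltr01)// hgamma.
  have /cvgr_gt/(_ _ g0) := hn (isT : (0 < k.+1)%N).
  apply: filterS => p; rewrite lt0n; apply: contraTneq => ->.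
  by rewrite mul0r ltxx.
have [p [[P1 P2] P3]] := filter_ex (filterI (filterI L1 L2) L3).
have i1 := resolvent_trace_integrable (G p) c0 k.
have i2 := resolvent_trace_integrable (G p) c0 k.+1.
move: P1 P2; rewrite (RintegralZl _ measurableT i1) (RintegralZl _ measurableT i2).
have := expected_resolvent_trace_le (hG p) P3 c0.
rewrite !ler_norml.
have N0 : 0 <= (n p 0%N)%:R^-1 :> R by rewrite invr_ge0.
move=> /(ler_wpM2l N0) le12 /andP[a1 a2] /andP[b1 b2].
move: le12 a1 a2 b1 b2; rewrite [e in _ + e]splitr; lra.
Qed.

End gram_limit.

Theorem proposition4p1 (R : realType)
  (gamma : nat -> R) (hgamma : forall l : nat, (0 < l)%N -> 1 <= gamma l)
  (n : nat -> nat -> nat) (hn0 : forall p : nat, n p 0%N = p)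
  (hn : forall l : nat, (0 < l)%N ->
    (fun p : nat => (n p l)%:R / p%:R : R) @ \oo --> gamma l)
  (d : measure_display) (T : measurableType d) (P : probability T R)
  (G : forall p : nat, layers P (n p))
  (hG : forall p : nat, gaussian_layers (G p))
  (nuMP : nat -> probability (measurableTypeR R) R)
  (hMP : forall l : nat, (0 < l)%N ->
    has_density (nuMP l) (mp_density (gamma l)))
  (mu : nat -> probability (measurableTypeR R) R)
  (hmu1 : mu 1%N = nuMP 1%N)
  (hmuS : forall k : nat, (0 < k)%N ->
    is_free_mul_convolution (mu k) (nuMP k.+1) (mu k.+1))
  (hlim : forall k : nat, (0 < k)%N ->
    weak_cvg_in_probability P
      (fun (p : nat) (w : T) => empirical_spectral_law (gram (G p) k w))
      (mu k)) :
  forall k : nat, (0 < k)%N ->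
    [/\ stieltjes_ge (mu k.+1) (mu k),
        (forall s2 : R, 0 < s2 -> forall w : R, 0 < w ->
          Lmap s2 (mu k) w <= Lmap s2 (mu k.+1) w) &
        (forall Pi : probability (measurableTypeR R) R,
          finite_second_moment Pi -> forall s2 : R, 0 < s2 ->
          exists tau1 tau2 : R,
            [/\ is_tauB_plus s2 Pi (mu k) tau1,
                is_tauB_plus s2 Pi (mu k.+1) tau2 &
                mmse Pi tau1 <= mmse Pi tau2])].
Proof.
(* [mu k] is the left factor of the next convolution, whose definition includes compact support;
   this covers [mu 1] as well. *)
have supp k : (0 < k)%N -> compact_support_nonneg (mu k).
  by move=> k0; have [] := hmuS k k0.
have suppMP k : (0 < k)%N -> compact_support_nonneg (nuMP k).
  case: k => [//|[_|k _]]; first by rewrite -hmu1; exact: supp.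
  by have [] := hmuS k.+1 isT.
have meanMP k : (0 < k)%N -> 0 < \int[nuMP k]_s s.
  by move=> k0; exact: (density_mean_gt0 (hMP k k0) (suppMP k k0)).
have mean k : (0 < k)%N -> 0 < \int[mu k]_s s.
  elim: k => [//|[_ _|k IHk _]]; first by rewrite hmu1 meanMP.
  by rewrite (free_mul_convolution_mean (hmuS k.+1 isT)) mulr_gt0 ?IHk ?meanMP.
move=> k k0.
have order : stieltjes_ge (mu k.+1) (mu k).
  exact: (gram_limit_stieltjes_ge hG hgamma hn (supp _ k0) (supp k.+1 isT) hlim k0).
split => //.
- move=> s2 s20 w w0.
  exact: (stieltjes_ge_Lmap (supp _ k0) (supp k.+1 isT) (mean _ k0) (mean k.+1 isT) order).
- move=> Pi Pi2 s2 s20.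
  exact: (stieltjes_ge_mmse (supp _ k0) (supp k.+1 isT) (mean _ k0) (mean k.+1 isT) order).
Qed.
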